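(* Let $0<t_1<t_2<\infty$, $1<\sigma\le 2$, $0<\kappa\le\sigma-1$, and let $q:[t_1,t_2]\to\mathbb{R}$ be continuous. Let $$\Omega=\frac{X_2^{\sigma-1}\left(\ln\frac{t_2}{t_1}-X_2\right)^{\sigma-\kappa-1}}{\left(\ln\frac{t_2}{t_1}\right)^{\sigma-1}t_1e^{X_2}},\qquad \mho=\frac{\kappa}{\sigma-1}\left(1-\frac{\kappa}{\sigma-1}\right)^{\frac{\sigma-\kappa-1}{\kappa}}\frac1{t_1}\left(\ln\frac{t_2}{t_1}\right)^{\sigma-\kappa-1},$$ $$X_2=\frac12\left(\ln\frac{t_2}{t_1}+2(\sigma-1)-\kappa-\sqrt{\Delta}\right),\qquad \Delta=\left(\ln\frac{t_2}{t_1}-\kappa\right)^2+4(\sigma-1)(\sigma-1-\kappa).$$ Assume that $$\int_{t_1}^{t_2}|q(\varsigma)|\,d\varsigma<\frac{\Gamma(\sigma-\kappa)}{\max\{\Omega,\mho\}}.$$ Then the boundary value problem $$\bigl({}^{\mathcal H}\mathfrak{D}^{\sigma}_{t_1+}x\bigr)(t)+\bigl({}^{\mathcal H}\mathfrak{D}^{\kappa}_{t_1+}(qx)\bigr)(t)=0,\quad t_1<t<t_2,\qquad x(t_1)=x(t_2)=0,$$ has no nontrivial solutions (i.e. no solution that is not identically zero).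
   Context: For $\alpha>0$ the left-sided Hadamard fractional integral of order $\alpha$ is $({}^{\mathcal H}\mathfrak{I}^{\alpha}_{t_1+}x)(t)=\frac1{\Gamma(\alpha)}\int_{t_1}^{t}\left(\ln\frac t\varsigma\right)^{\alpha-1}\frac{x(\varsigma)}{\varsigma}\,d\varsigma$, and ${}^{\mathcal H}\mathfrak{I}^{0}_{t_1+}x=x$. For $n-1<\alpha\le n$, $n\in\mathbb{N}$, the left-sided Hadamard fractional derivative of order $\alpha$ is $({}^{\mathcal H}\mathfrak{D}^{\alpha}_{t_1+}x)(t)=\delta^n({}^{\mathcal H}\mathfrak{I}^{n-\alpha}_{t_1+}x)(t)$ with $\delta=t\frac{d}{dt}$. A solution is a function $x\in C([t_1,t_2],\mathbb{R})$ for which the Hadamard derivatives in the equation, given by these formulas, exist on $(t_1,t_2)$, the equation holds there, and the boundary conditions hold. $\Gamma$ is the Euler Gamma function. In the boundary case $\kappa=\sigma-1$ the convention $0^0=1$ is used. *)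

(* Defs.v *)
From HB Require Import structures.
From mathcomp Require Import all_boot all_order all_algebra.
From mathcomp Require Import all_classical all_reals all_analysis.

Set Implicit Arguments.
Unset Strict Implicit.
Unset Printing Implicit Defensive.

Import Order.TTheory GRing.Theory Num.Theory.
Import numFieldNormedType.Exports.

Local Open Scope classical_set_scope.
Local Open Scope ring_scope.

Section Hadamard.
Context {R : realType}.
Implicit Types (a t s : R) (x : R -> R).

Definition Gamma a : R :=
  \int[@lebesgue_measure R]_(s in `]0, +oo[) (s `^ (a - 1) * expR (- s)).

(* Meant for a >= 0.  The integral is a Lebesgue integral; it converges for
   every a > 0 and t in `]t1, t2[ when 0 < t1 and x is continuous on
   `[t1, t2]. *)
Definition hadamard_int t1 a x : R -> R := fun t =>
  if a == 0 then x t
  else (Gamma a)^-1 *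
    \int[@lebesgue_measure R]_(s in `[t1, t]) (ln (t / s) `^ (a - 1) * (x s / s)).

Definition delta x : R -> R := fun t => t * derive1 x t.

(* For a > 0, the integer n such that n - 1 < a <= n; see hadamard_orderE. *)
Definition hadamard_order a : nat := `|Num.ceil a|%N.

Lemma hadamard_orderE a (n : nat) :
  0 < a -> n%:R - 1 < a <= n%:R -> hadamard_order a = n.
Proof.
move=> a0 /andP[an na]; rewrite /hadamard_order.
by rewrite (@ceil_def _ _ n%:Z) // intrB an na.
Qed.

Definition hadamard_der t1 a x : R -> R :=
  let n := hadamard_order a in
  iter n delta (hadamard_int t1 (n%:R - a) x).

(* derive1 is total, so the value hadamard_der t1 a x t is meaningful on
   `]t1, t2[ only if each of the n successive applications of delta is to a
   function differentiable there. *)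
Definition hadamard_derivable t1 t2 a x : Prop :=
  let n := hadamard_order a in
  forall k t, (k < n)%N -> t1 < t < t2 ->
    derivable (iter k delta (hadamard_int t1 (n%:R - a) x)) t 1.

(* Functions on [t1, t2] are represented by functions on R whose values
   outside [t1, t2] are never used. *)
Definition bvp_solution t1 t2 (sigma kappa : R) (q x : R -> R) : Prop :=
  [/\ {within `[t1, t2], continuous x},
      hadamard_derivable t1 t2 sigma x,
      hadamard_derivable t1 t2 kappa (q \* x),
      forall t, t1 < t < t2 ->
        hadamard_der t1 sigma x t + hadamard_der t1 kappa (q \* x) t = 0
    & x t1 = 0 /\ x t2 = 0].

Definition Delta t1 t2 (sigma kappa : R) : R :=
  (ln (t2 / t1) - kappa) ^+ 2 + 4 * (sigma - 1) * (sigma - 1 - kappa).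

Definition X2 t1 t2 (sigma kappa : R) : R :=
  2^-1 * (ln (t2 / t1) + 2 * (sigma - 1) - kappa
          - Num.sqrt (Delta t1 t2 sigma kappa)).

(* Here and in Mho, the convention 0^0 = 1 needed when kappa = sigma - 1 is
   that of powR (lemma powRr0). *)
Definition Omega t1 t2 (sigma kappa : R) : R :=
  let L := ln (t2 / t1) in
  let X := X2 t1 t2 sigma kappa in
  X `^ (sigma - 1) * (L - X) `^ (sigma - kappa - 1)
  / (L `^ (sigma - 1) * t1 * expR X).

Definition Mho t1 t2 (sigma kappa : R) : R :=
  kappa / (sigma - 1)
  * (1 - kappa / (sigma - 1)) `^ ((sigma - kappa - 1) / kappa)
  * t1^-1 * ln (t2 / t1) `^ (sigma - kappa - 1).

End Hadamard.

(* Main.v *)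
(** Applying the Hadamard integral of order [sigma - 1] to the once integrated
    equation and using the semigroup law (a Beta integral computation) gives
    [x t = C * ln (t / t1) `^ (sigma - 1) - I^(sigma - kappa) (q x) t].  The
    condition at [t2] determines [C], so that [x] is the integral of [q x]
    against a Green function divided by [Gamma (sigma - kappa)].

    With [L = ln (t2 / t1)], [u = ln (t / t1)], [v = ln (s / t1)],
    [a = sigma - 1] and [b = sigma - kappa - 1 < a <= 1], the Green function is
    [((u / L)^a (L - v)^b - [v < u] (u - v)^b) / s] with [s = t1 e^v].  From
    above it is at most [(v / L)^a (L - v)^b e^(-v) / t1], because
    [u^a - v^a <= (u - v)^a], and this function of [v] is maximal at [X2].
    From below, putting [w = (u - v) / (L - v) <= u / L], it is at least
    [- L^b (w^b - w^a) / t1 >= - Mho].  At a maximum point of [`|x|] the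
    smallness assumption on [q] then contradicts [x <> 0]. *)

Require Import Defs.
From HB Require Import structures.
From mathcomp Require Import all_boot all_order all_algebra.
From mathcomp Require Import all_classical all_reals all_analysis.
From mathcomp Require Import measurable_realfun.
From mathcomp Require Import ring lra.

Set Implicit Arguments.
Unset Strict Implicit.
Unset Printing Implicit Defensive.

Import Order.TTheory GRing.Theory Num.Theory.
Import numFieldNormedType.Exports.

Local Open Scope classical_set_scope.
Local Open Scope ring_scope.

(** * Bounds on the Green function *)

(** The equation holds only on the open interval and [x] is merely continuous, so the derivatives
    give no information at [t1]. Two integrations leave two constants. The one from the outer
    [delta] survives as [C]; the inner one is 0 because [I^(2 - sigma) x] tends to 0 at [t1], which
    for [sigma = 2] is the condition [x t1 = 0]. The semigroup law identifies only [I^1 x]. So [x]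
    itself is recovered by differentiation, which needs a continuous candidate: its integral part is
    continuous because [sigma - kappa >= 1]. The law itself rests on Tonelli's theorem. Gamma and
    Beta integrals are therefore handled in [\bar R] with non-negative integrands, finiteness being
    deduced from the identities. A bounded signed function is then a difference of two non-negative
    ones. *)

Section Inequalities.
Context {R : realType}.
Implicit Types a b k p u v w x y z : R.

(** Write [z ^ p] as [x ^ p * (z / x) ^ p] and use [ln y <= y - 1]. The maxima below are found
    without derivatives: such bounds are multiplied at the critical point, where the exponents
    cancel or have a sign. *)
Lemma powR_tangent z x p : 0 < z -> 0 < x -> 0 <= p ->
  z `^ p <= x `^ p * expR (p * (z / x - 1)).
Proof.
move=> z0 x0 p0; rewrite /powR !gt_eqF// -expRD ler_expR -mulrDr ler_wpM2l//.
have zx0 : 0 < z / x by rewrite divr_gt0.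
have := le_ln1Dx (x := z / x - 1).
rewrite ltrBrDl subrr zx0 => /(_ isT); rewrite addrC subrK ln_div ?posrE//.
lra.
Qed.

(** For [v < u], the numbers [v / u] and [(u - v) / u] sum to 1 and lie in []0, 1]], where
    [c <= c ^ a]. *)
Lemma sub_powR_le u v a : 0 < v -> v <= u -> 0 <= a <= 1 ->
  u `^ a - v `^ a <= (u - v) `^ a.
Proof.
move=> v0 vu /andP[a0 a1].
have u0 : 0 < u by apply: lt_le_trans vu.
have [->|uv] := eqVneq u v.
  by rewrite subrr powR_ge0.
have uv0 : 0 < u - v by rewrite subr_gt0 lt_neqAle eq_sym uv.
have step c : 0 < c -> c <= u -> c / u <= (c / u) `^ a.
  move=> c0 cu; apply: ger1_powR => //.
  by rewrite divr_gt0//= ler_pdivrMr// mul1r.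
have E c : 0 < c -> c `^ a = u `^ a * (c / u) `^ a.
  move=> c0; rewrite -powRM ?ltW ?divr_gt0//; congr powR; field; lra.
rewrite lerBlDr (E v)// (E (u - v))// -mulrDr.
rewrite -[leLHS]mulr1 ler_wpM2l ?powR_ge0//.
have -> : 1 = (u - v) / u + v / u by field; lra.
by apply: lerD; apply: step => //; lra.
Qed.

(** In the variable [z = w ^ (a - b)] the left-hand side is [z ^ p * (1 - z)] with
    [p = b / (a - b)], which peaks at [z = p / (p + 1) = b / a]. *)
Lemma powR_sub_powR_max w a b : 0 < w <= 1 -> 0 <= b -> b < a ->
  w `^ b - w `^ a <= (1 - b / a) * (b / a) `^ (b / (a - b)).
Proof.
move=> /andP[w0 w1] b0 ba.
have a0 : 0 < a by lra.
have k0 : 0 < a - b by lra.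
set p := b / (a - b); set z := w `^ (a - b).
have z0 : 0 < z by rewrite powR_gt0.
have z1 : z <= 1.
  by rewrite /z -(powRr0 w) ger_powR ?w0//; lra.
have -> : w `^ a = w `^ b * z.
  by rewrite /z -powRD ?gt_eqF ?implybT// addrC subrK.
have -> : w `^ b = z `^ p.
  rewrite /z -powRrM; congr powR; rewrite /p; field; lra.
(* The tangent point [b / a] would be 0; here the bound is [1 * 0 ^ 0 = 1]. *)
have [b00|bn0] := eqVneq b 0.
  by rewrite /p b00 !mul0r !powRr0 subr0; lra.
have {}b0 : 0 < b by rewrite lt_neqAle eq_sym bn0.
have Z0 : 0 < b / a by rewrite divr_gt0.
have Z1 : 0 < 1 - b / a by rewrite subr_gt0 ltr_pdivrMr// mul1r.
have [z1'|z1'] := eqVneq z 1.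
  rewrite z1' powR1 mul1r subrr mulr_ge0 ?powR_ge0//; lra.
have {}z1 : 0 < 1 - z by rewrite subr_gt0 lt_neqAle z1'.
have H1 := powR_tangent z0 Z0 (p := p) (ltW (divr_gt0 b0 k0)).
have H2 := powR_tangent z1 Z1 (p := 1) ler01.
rewrite !powRr1 ?(ltW z1) ?(ltW Z1) // in H2.
have : z `^ p * (1 - z) <= (b / a) `^ p * expR (p * (z / (b / a) - 1)) *
   ((1 - b / a) * expR (1 * ((1 - z) / (1 - b / a) - 1))).
  by apply: ler_pM => //; [exact: powR_ge0|exact: ltW].
rewrite mulrBr mulr1 => /le_trans; apply.
rewrite mulrACA -expRD.
(* At the critical point the two first-order exponents are opposite. *)
have -> : p * (z / (b / a) - 1) + 1 * ((1 - z) / (1 - b / a) - 1) = 0.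
  by rewrite /p; field; rewrite !gt_eqF//.
by rewrite expR0 mulr1 mulrC.
Qed.



(* X is a critical point of the logarithm of the left-hand side, i.e. a root of
   a (L - X) - b X - X (L - X), so by concavity tangent lines at X suffice. *)
Lemma powR_powR_expR_max (L a b v X : R) : 0 < L -> 0 < a -> 0 <= b -> 0 < v < L ->
  X = 2^-1 * (L + a + b - Num.sqrt ((L - (a - b)) ^+ 2 + 4 * a * b)) ->
  v `^ a * (L - v) `^ b * expR (- v) <= X `^ a * (L - X) `^ b * expR (- X).
Proof.
move=> L0 a0 b0 /andP[v0 vL]; set D := (Y in Num.sqrt Y) => XE.
have D_ge0 : 0 <= D by rewrite addr_ge0 ?sqr_ge0// !mulr_ge0// ltW.
have S0 : 0 < L + a + b by lra.
have root : X * X - (L + a + b) * X + a * L = 0.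
  have := sqr_sqrtr D_ge0; rewrite XE expr2; set r := Num.sqrt _ => H.
  have -> : 2^-1 * (L + a + b - r) * (2^-1 * (L + a + b - r)) -
    (L + a + b) * (2^-1 * (L + a + b - r)) + a * L =
    4^-1 * (r * r - (L + a + b) ^+ 2 + 4 * a * L) by field.
  by rewrite H /D; field.
(* Positivity means [D < (L + a + b) ^ 2], the gap being [4 * a * L]. The next bound, [X <= L],
   comes from [(a + b - L) ^ 2 <= D], the gap being [4 * b * L]. *)
have X0 : 0 < X.
  rewrite XE mulr_gt0 ?invr_gt0// subr_gt0 -[ltRHS](gtr0_norm S0).
  rewrite -sqrtr_sqr ltr_sqrt; last by rewrite exprn_gt0.
  rewrite /D; nra.
have XL : X <= L.
  rewrite XE ler_pdivrMl// lerBlDl -lerBlDr.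
  have [h|h] := leP (L + a + b - 2 * L) 0; first by rewrite (le_trans h)// sqrtr_ge0.
  rewrite -[leLHS]ger0_norm ?(ltW h)// -sqrtr_sqr ler_wsqrtr// /D; nra.
have H1 := powR_tangent v0 X0 (ltW a0).
have [bE|bn0] := eqVneq b 0.
  rewrite bE !powRr0 !mulr1.
  apply: le_trans (ler_wpM2r (expR_ge0 _) H1) _.
  rewrite -mulrA -expRD ler_wpM2l ?powR_ge0// ler_expR.
  (* For [b = 0], [X] is the smaller of [a] and [L]. In the case [X = L], [Num.sqrt D = a - L]
     forces [a >= X], while [X > v]. *)
  have aX : (X - v) * (a - X) >= 0.
    rewrite bE in root.
    have /eqP : (X - L) * (X - a) = 0 by rewrite -root; ring.
    rewrite mulf_eq0 !subr_eq0 => /orP[|] /eqP E; last by rewrite E subrr mulr0.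
    have h2 := sqrtr_ge0 D.
    have E2 : Num.sqrt D = a + b - L by move: E; rewrite XE; lra.
    rewrite mulr_ge0// ?E; lra.
  rewrite -subr_ge0.
  have -> : - X - (a * (v / X - 1) - v) = (X - v) * (a - X) / X by field; rewrite gt_eqF.
  by rewrite divr_ge0// ltW.
have {}b0 : 0 < b by rewrite lt_neqAle eq_sym bn0.
(* At [X = L] the quadratic takes the value [- b * L], which is nonzero; the tangent bound for the
   second factor requires [0 < L - X]. *)
have {}XL : X < L.
  rewrite lt_neqAle XL andbT; apply/eqP => XLE.
  move: root; rewrite XLE => H; have : b * L = 0 by lra.
  by move/eqP; rewrite mulf_eq0 !gt_eqF.
have Lv : 0 < L - v by lra.
have LX : 0 < L - X by lra.
have H2 := powR_tangent Lv LX (ltW b0).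
apply: le_trans (ler_wpM2r (expR_ge0 _) (ler_pM _ _ H1 H2)) _; rewrite ?powR_ge0//.
rewrite mulrACA -expRD -[leLHS]mulrA -expRD ler_wpM2l ?mulr_ge0 ?powR_ge0// ler_expR.
rewrite -subr_ge0.
set E := (Y in 0 <= Y).
(* The gap between the exponents is a multiple of the quadratic that vanishes at [X]. *)
suff -> : E = (v - X) * (X * X - (L + a + b) * X + a * L) / (X * (L - X)) * (-1).
  by rewrite root mulr0 !mul0r.
by rewrite /E; field; rewrite !gt_eqF.
Qed.

Lemma le_Omega (t1 t2 sigma kappa v : R) : 0 < t1 ->
  1 < sigma -> kappa <= sigma - 1 -> 0 < v < ln (t2 / t1) ->
  (v / ln (t2 / t1)) `^ (sigma - 1) * (ln (t2 / t1) - v) `^ (sigma - kappa - 1)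
    / (t1 * expR v) <= Omega t1 t2 sigma kappa.
Proof.
move=> t10 s1 ks; set L := ln _ => vL.
have L0 : 0 < L by case/andP: vL => /lt_trans; exact.
have XE : X2 t1 t2 sigma kappa = 2^-1 * (L + (sigma - 1) + (sigma - kappa - 1) -
    Num.sqrt ((L - (sigma - 1 - (sigma - kappa - 1))) ^+ 2
              + 4 * (sigma - 1) * (sigma - kappa - 1))).
  have -> : sigma - kappa - 1 = sigma - 1 - kappa by ring.
  have -> : sigma - 1 - (sigma - 1 - kappa) = kappa by ring.
  by rewrite /X2 /Delta -/L; congr (_ * (_ - _)); ring.
have a0 : 0 < sigma - 1 by lra.
have b0 : 0 <= sigma - kappa - 1 by lra.
have H := powR_powR_expR_max L0 a0 b0 vL XE.
rewrite /Omega -/L; set X := X2 _ _ _ _ in H *.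
have v0 : 0 < v by case/andP: vL.
rewrite powRM ?invr_ge0 ?(ltW v0) ?(ltW L0)// -powR_inv1 ?(ltW L0)// -powRrM mulN1r powRN.
have P : 0 < L `^ (sigma - 1) by rewrite powR_gt0.
have C0 : 0 <= (L `^ (sigma - 1) * t1)^-1 by rewrite invr_ge0 mulr_ge0 ?ltW.
have := ler_wpM2r C0 H.
have -> : expR v = (expR (- v))^-1 by rewrite expRN invrK.
have -> : expR X = (expR (- X))^-1 by rewrite expRN invrK.
rewrite !invfM !invrK.
by congr (_ <= _); ring.
Qed.

Lemma le_Mho (t1 t2 sigma kappa w : R) : 0 < t1 ->
  1 < sigma -> 0 < kappa <= sigma - 1 -> 0 < w <= 1 ->
  (w `^ (sigma - kappa - 1) - w `^ (sigma - 1)) *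
   ln (t2 / t1) `^ (sigma - kappa - 1) / t1 <= Mho t1 t2 sigma kappa.
Proof.
move=> t10 s1 /andP[k0 ks] w01.
have b0 : 0 <= sigma - kappa - 1 by lra.
have ba : sigma - kappa - 1 < sigma - 1 by lra.
have := @powR_sub_powR_max w (sigma - 1) (sigma - kappa - 1) w01 b0 ba.
have -> : (sigma - kappa - 1) / (sigma - 1) = 1 - kappa / (sigma - 1) by field; lra.
have -> : sigma - 1 - (sigma - kappa - 1) = kappa by ring.
rewrite opprB addrCA subrr addr0 => H.
rewrite /Mho (mulrAC _ (t1^-1)) ler_wpM2r ?invr_ge0 ?(ltW t10)//.
by rewrite ler_wpM2r ?powR_ge0.
Qed.

(** Makes the maximum of [Omega] and [Mho] positive, so that the smallness assumption can be
    multiplied out. *)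
Lemma Mho_gt0 (t1 t2 sigma kappa : R) : 0 < t1 -> t1 < t2 ->
  1 < sigma -> 0 < kappa <= sigma - 1 -> 0 < Mho t1 t2 sigma kappa.
Proof.
move=> t10 t12 s1 /andP[k0 ks]; rewrite /Mho.
have L0 : 0 < ln (t2 / t1) by rewrite ln_gt0// ltr_pdivlMr// mul1r.
have a0 : 0 < sigma - 1 by lra.
rewrite mulr_gt0 ?powR_gt0// mulr_gt0 ?invr_gt0// mulr_gt0 ?divr_gt0//.
(* Here the base [1 - kappa / (sigma - 1)] is 0, and positivity rests on [0 ^ 0 = 1]. *)
have [->|ne] := eqVneq kappa (sigma - 1).
  have -> : sigma - (sigma - 1) - 1 = 0 by ring.
  by rewrite mul0r powRr0.
by rewrite powR_gt0// subr_gt0 ltr_pdivrMr ?mul1r// lt_neqAle ne.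
Qed.

Lemma green_bound (t1 t2 sigma kappa : R) u v : 0 < t1 -> t1 < t2 ->
  1 < sigma <= 2 -> 0 < kappa <= sigma - 1 ->
  0 < u <= ln (t2 / t1) -> 0 < v < ln (t2 / t1) ->
  `|(u / ln (t2 / t1)) `^ (sigma - 1) * (ln (t2 / t1) - v) `^ (sigma - kappa - 1)
    - (if v < u then (u - v) `^ (sigma - kappa - 1) else 0)| / (t1 * expR v)
  <= Num.max (Omega t1 t2 sigma kappa) (Mho t1 t2 sigma kappa).
Proof.
move=> t10 t12 /andP[s1 s2] k /andP[u0 uL] vL.
have /andP[k0 ks] := k.
have O := le_Omega t10 s1 ks vL.
have M := fun w => le_Mho t2 t10 s1 k (w := w).
move: vL O M => /andP[v0 vL]; set L := ln _ in uL vL *.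
set a := sigma - 1; set b := sigma - kappa - 1 => O M.
have L0 : 0 < L by lra.
have ev0 : 0 < t1 * expR v by rewrite mulr_gt0 ?expR_gt0.
have a01 : 0 < a <= 1 by rewrite /a; lra.
have b01 : 0 <= b < 1 by rewrite /b; lra.
rewrite le_max.
(* Without the second term the kernel increases with [u], so for [u <= v] the worst case is
   [u = v]. *)
have [uv|vu] := leP u v; rewrite ?subr0.
  apply/orP; left; apply: le_trans O.
  rewrite ger0_norm ?mulr_ge0 ?powR_ge0// ler_wpM2r ?invr_ge0 ?(ltW ev0)//.
  rewrite ler_wpM2r ?powR_ge0// ge0_ler_powR ?nnegrE ?divr_ge0 ?ler_pM2r ?invr_gt0//; lra.
have uv0 : 0 < u - v by lra.
have Lv0 : 0 < L - v by lra.
have [h|h] := leP 0 ((u / L) `^ a * (L - v) `^ b - (u - v) `^ b).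
  apply/orP; left; rewrite ger0_norm//; apply: le_trans O.
  rewrite ler_wpM2r ?invr_ge0 ?(ltW ev0)// lerBlDl -lerBlDr -mulrBl.
  have dL : u / L - v / L = (u - v) / L by field; lra.
  (* Subadditivity of the power [a], then passage to the smaller exponent [b], the base being at
     most 1. Multiplying by [(L - v) ^ b <= L ^ b] then leaves at most [(u - v) ^ b]. *)
  have dl : (u / L) `^ a - (v / L) `^ a <= ((u - v) / L) `^ b.
    apply: le_trans (sub_powR_le _ _ _) _; rewrite ?divr_gt0 ?ler_pM2r ?invr_gt0 ?dL//; try lra.
    by rewrite ger_powR// ?divr_gt0//= ?ler_pdivrMr// /a /b; lra.
  apply: le_trans (ler_wpM2r (powR_ge0 _ _) dl) _.
  rewrite -powRM ?divr_ge0//; try lra.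
  rewrite ge0_ler_powR ?nnegrE ?mulr_ge0 ?invr_ge0//; try lra.
  by rewrite mulrAC ler_pdivrMr// ler_pM2l//; lra.
apply/orP; right; rewrite ltr0_norm// opprB.
set w := (u - v) / (L - v).
have w01 : 0 < w <= 1.
  by rewrite divr_gt0//= ler_pdivrMr// mul1r; lra.
apply: le_trans (M _ w01).
(* Cleared of denominators this reads [u * v <= L * v]. It lets [u / L] be lowered to [w], so that a
   function of [w] alone remains to be maximized. *)
have wL : w <= u / L.
  by rewrite /w ler_pdivrMr// mulrAC ler_pdivlMr//; nra.
have E : (u - v) `^ b = w `^ b * (L - v) `^ b.
  rewrite -powRM; [|lra|lra]; congr powR; rewrite /w; field; lra.
rewrite E -mulrBl.
have H : (w `^ b - (u / L) `^ a) <= w `^ b - w `^ a.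
  rewrite lerD2l lerN2 ge0_ler_powR ?nnegrE//; lra.
have H0 : 0 <= w `^ b - (u / L) `^ a.
  move/ltW: h; rewrite E -mulrBl -oppr_ge0 -mulNr opprB pmulr_lge0// powR_gt0//.
apply: ler_pM.
- by rewrite mulr_ge0// powR_ge0.
- by rewrite invr_ge0 ltW.
- apply: ler_pM => //; first exact: powR_ge0.
  rewrite ge0_ler_powR ?nnegrE//; lra.
(* Only [1 <= expR v] is used here, which is why [Mho] has no exponential factor. *)
- rewrite lef_pV2 ?posrE// ler_peMr ?(ltW t10)// -expR0 ler_expR; lra.
Qed.

End Inequalities.

(** * Change of variables *)

Section ChangeOfVariables.
Context {R : realType}.
Notation mu := (@lebesgue_measure R).

(** Substitution on each segment [[a n, b n]], followed by monotone convergence on both sides.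
    Nothing is asked at the ends of [D], where the Gamma and Beta integrands may blow up, and both
    sides may be infinite. *)
Lemma ge0_integration_by_substitution_bigcup (F F' G : R -> R)
    (a b : nat -> R) (D : set R) :
  open D -> D = \bigcup_n `[a n, b n]%classic ->
  nonincreasing_seq a -> nondecreasing_seq b -> (forall n, a n <= b n) ->
  {in D &, {homo F : x y / x < y}} ->
  (forall x, D x -> is_derive x (1 : R) F (F' x)) ->
  (forall x, D x -> {for x, continuous F'}) -> (forall x, D x -> 0 <= F' x) ->
  (forall x, D x -> {for F x, continuous G}) -> (forall x, D x -> 0 <= G (F x)) ->
  (\int[mu]_(y in F @` D) (G y)%:E = \int[mu]_(x in D) (G (F x) * F' x)%:E)%E.
Proof.
move=> oD DE na nb ab Finc dF cF' F'0 cGF GF0.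
have abD n : `[a n, b n] `<=` D by rewrite DE => x ?; exists n.
have aD n : D (a n) by apply: (abD n); rewrite /= in_itv/= lexx ab.
have bD n : D (b n) by apply: (abD n); rewrite /= in_itv/= lexx ab.
have Fle x y : D x -> D y -> x <= y -> F x <= F y.
  move=> Dx Dy; rewrite le_eqVlt => /predU1P[->//|xy].
  by apply/ltW/Finc; rewrite ?inE.
have cF x : D x -> {for x, continuous F}.
  by move=> Dx; apply/differentiable_continuous/derivable1_diffP; have [] := dF _ Dx.
pose E := F @` D; have cG y : E y -> {for y, continuous G} by case=> x Dx <-; exact: cGF.
have G0 y : E y -> 0 <= G y by case=> x Dx <-; exact: GF0.
(* By the intermediate value theorem no value between [F (a n)] and [F (b n)] is missed, so these
   segments exhaust the image of [D]. *)
have FabE n : `[F (a n), F (b n)] `<=` E.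
  move=> y /=; rewrite in_itv/= => /andP[ay yb].
  have Fab : F (a n) <= F (b n) by rewrite Fle.
  have [x xab <-] := @IVT _ F _ _ y (ab n)
    (continuous_in_subspaceT (fun z zab => cF _ (abD n _ (set_mem zab))))
    ltac:(by rewrite min_l// max_r// ay).
  by exists x => //; exact: (abD n).
have FD x : D x -> E (F x) by exists x.
have EE : E = \bigcup_n `[F (a n), F (b n)]%classic.
  apply/seteqP; split=> [_ [x + <-]|y [n _]]; last exact: FabE.
  rewrite {1}DE => -[n _ /=] /[dup] xab; rewrite in_itv/= => /andP[ax xb].
  by exists n => //=; rewrite in_itv/= !Fle//; exact: (abD n).
have F'E x : D x -> derive1 F x = F' x.
  by move=> Dx; rewrite derive1E; have [] := dF _ Dx.
have F'near x : D x -> \forall y \near x, derive1 F y = F' y.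
  move=> Dx; near=> y; apply: F'E; near: y; exact: open_nbhs_nbhs.
have cF'1 x : D x -> {for x, continuous (derive1 F)}.
  move=> Dx; rewrite /prop_for /continuous_at F'E//.
  apply: cvg_trans (cF' _ Dx); apply: near_eq_cvg.
  by near=> y; apply/esym; near: y; exact: F'near.
have mGF : measurable_fun D (fun x => G (F x) * F' x).
  apply: open_continuous_measurable_fun => // x /[!inE] Dx.
  apply: (@continuousM _ _ (G \o F) F'); last exact: cF'.
  by apply: continuous_comp; [exact: cF|apply: cG; exact: FD].
have step n : (\int[mu]_(y in `[F (a n), F (b n)]) (G y)%:E =
   \int[mu]_(x in `[a n, b n]) (G (F x) * F' x)%:E)%E.
  rewrite integration_by_substitution_increasing//.
  - by apply: eq_integral => x /[!inE] xab; rewrite -F'E//; exact: (abD n).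
  - by move=> x y xab yab; apply: Finc; rewrite inE; exact: (abD n).
  - by move=> x xab; apply: cF'1; apply: (abD n); exact: subset_itv_oo_cc.
  - by apply/cvg_ex; exists (derive1 F (a n)); apply: cvg_at_right_filter; exact: cF'1.
  - by apply/cvg_ex; exists (derive1 F (b n)); apply: cvg_at_left_filter; exact: cF'1.
  - split.
    + move=> x xab; have [] := dF x => //.
      by apply: (abD n); exact: subset_itv_oo_cc.
    + by apply: cvg_at_right_filter; exact: cF.
    + by apply: cvg_at_left_filter; exact: cF.
  - apply: continuous_in_subspaceT => y /[!inE] yE; apply: cG; exact: (FabE n).
have L : (\int[mu]_(y in `[F (a n), F (b n)]) (G y)%:E @[n --> \oo] -->
   \int[mu]_(y in E) (G y)%:E)%E.
  rewrite EE; apply: ge0_nondecreasing_set_cvg_integral => //.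
  - move=> m n mn; rewrite subsetEset; apply: subset_itv; rewrite bnd_simp Fle//.
      exact: na.
    exact: nb.
  - move=> n; apply/measurable_EFinP; apply: subspace_continuous_measurable_fun => //.
    apply: continuous_in_subspaceT => y /[!inE] yE; apply: cG; exact: (FabE n).
  - by move=> n y yE; rewrite lee_fin; apply: G0; exact: (FabE n).
have L' : (\int[mu]_(x in `[a n, b n]) (G (F x) * F' x)%:E @[n --> \oo] -->
   \int[mu]_(x in D) (G (F x) * F' x)%:E)%E.
  rewrite DE; apply: ge0_nondecreasing_set_cvg_integral => //.
  - move=> m n mn; rewrite subsetEset; apply: subset_itv; rewrite bnd_simp.
      exact: na.
    exact: nb.
  - move=> n; apply/measurable_EFinP; apply: measurable_funS mGF => //.
    exact: open_measurable.
  - move=> n x xab; have Dx := abD _ _ xab.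
    by rewrite lee_fin mulr_ge0// ?F'0//; apply: G0; exact: FD.
move: L; under eq_fun do rewrite step.
by move=> /(cvg_unique _); exact.
Unshelve. all: by end_near. Qed.

(** Starting at [n.+2] makes every segment nonempty: the first one is the point [1 / 2]. *)
Lemma itv01_bigcup : `]0, 1[%classic =
  \bigcup_n `[(n.+2%:R^-1 : R), 1 - n.+2%:R^-1]%classic.
Proof.
have pn n : 0 < (n.+2%:R^-1 : R) by rewrite invr_gt0.
apply/seteqP; split=> [x|x [n _]] /=; rewrite !in_itv/= => /andP[x0 x1]; last first.
  by rewrite (lt_le_trans (pn n))// (le_lt_trans x1)// ltrBlDr ltrDl.
have m0 : 0 < Num.min x (1 - x) by rewrite lt_min x0 subr_gt0.
have := truncnS_gt (Num.min x (1 - x))^-1; set n := Num.trunc _ => h.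
have {}h : n.+2%:R^-1 <= Num.min x (1 - x).
  rewrite -[leRHS]invrK lef_pV2 ?posrE ?invr_gt0// (le_trans (ltW h))// ler_nat//.
move: h; rewrite le_min => /andP[h1 h2].
by exists n => //=; rewrite in_itv/= h1 lerBrDr -lerBrDl.
Qed.

Lemma itv0y_bigcup : `]0, +oo[%classic =
  \bigcup_n `[(n.+1%:R^-1 : R), n.+1%:R]%classic.
Proof.
have pn n : 0 < (n.+1%:R^-1 : R) by rewrite invr_gt0.
apply/seteqP; split=> [x|x [n _]] /=; rewrite !in_itv/= => /andP[x0 x1]; last first.
  by rewrite (lt_le_trans (pn n)).
have := truncnS_gt (Num.max x x^-1); set n := Num.trunc _ => h.
move: h; rewrite gt_max => /andP[h1 h2].
exists n => //=; rewrite in_itv/= (ltW h1) andbT.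
by rewrite -[leRHS]invrK lef_pV2 ?posrE ?invr_gt0// ltW.
Qed.

Lemma ge0_integration_by_substitution01 (F F' G : R -> R) :
  {in `]0, 1[%classic &, {homo F : x y / x < y}} ->
  (forall x : R, 0 < x < 1 -> is_derive x (1 : R) F (F' x)) ->
  (forall x : R, 0 < x < 1 -> {for x, continuous F'}) -> (forall x : R, 0 < x < 1 -> 0 <= F' x) ->
  (forall x : R, 0 < x < 1 -> {for F x, continuous G}) ->
  (forall x : R, 0 < x < 1 -> 0 <= G (F x)) ->
  (\int[mu]_(y in F @` `]0%R, 1%R[) (G y)%:E = \int[mu]_(x in `]0%R, 1%R[) (G (F x) * F' x)%:E)%E.
Proof.
move=> Finc dF cF' F'0 cG G0.
have I (x : R) : `]0, 1[%classic x = (0 < x < 1) :> Prop by rewrite /= in_itv.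
apply: (ge0_integration_by_substitution_bigcup _ itv01_bigcup) => //;
  try by move=> x; rewrite I; auto.
- by move=> m n mn; rewrite lef_pV2 ?posrE// ler_nat.
- by move=> m n mn; rewrite lerD2l lerN2 lef_pV2 ?posrE// ler_nat.
- move=> n; rewrite lerBrDr -mulr2n -[leLHS]mulr_natr ler_pdivrMl// mulr1 ler_nat//.
Qed.

Lemma ge0_integration_by_substitution0y (F F' G : R -> R) :
  {in `]0, +oo[%classic &, {homo F : x y / x < y}} ->
  (forall x : R, 0 < x -> is_derive x (1 : R) F (F' x)) ->
  (forall x : R, 0 < x -> {for x, continuous F'}) -> (forall x : R, 0 < x -> 0 <= F' x) ->
  (forall x : R, 0 < x -> {for F x, continuous G}) ->
  (forall x : R, 0 < x -> 0 <= G (F x)) ->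
  (\int[mu]_(y in F @` `]0%R, +oo[) (G y)%:E = \int[mu]_(x in `]0%R, +oo[) (G (F x) * F' x)%:E)%E.
Proof.
move=> Finc dF cF' F'0 cG G0.
have I (x : R) : `]0, +oo[%classic x = (0 < x) :> Prop by rewrite /= in_itv/= andbT.
apply: (ge0_integration_by_substitution_bigcup _ itv0y_bigcup) => //;
  try by move=> x; rewrite I; auto.
- by move=> m n mn; rewrite lef_pV2 ?posrE// ler_nat.
- by move=> m n mn; rewrite ler_nat.
- by move=> n; rewrite (@le_trans _ _ 1)// ?invf_le1 ?ler1n.
Qed.

End ChangeOfVariables.

(** * Gamma and Beta integrals *)

Section GammaBeta.
Context {R : realType}.
Notation mu := (@lebesgue_measure R).
Implicit Types a b c r s t u v w x y : R.

Section triangle.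
Variables (D : set R) (h : R * R -> R).
Hypotheses (mD : measurable D) (mh : measurable_fun setT h).
Hypothesis h0 : forall x y, D x -> D y -> x < y -> 0 <= h (x, y).

Let T := [set p : R * R | [/\ D p.1, D p.2 & p.1 < p.2]].
Let f := (EFin \o h) \_ T.

Let mT : measurable T.
Proof.
have -> : T = (fst @^-1` D) `&` (snd @^-1` D) `&` [set p : R * R | p.1 < p.2].
  by apply/seteqP; split=> p /=; [case|move=> [[]]].
apply: measurableI; first apply: measurableI.
- by rewrite -[X in measurable X]setTI; exact: measurable_fst.
- by rewrite -[X in measurable X]setTI; exact: measurable_snd.
- by rewrite -[X in measurable X]setTI; apply: measurable_fun_ltr.
Qed.

Let mf : measurable_fun setT f.
Proof.
apply/(measurable_restrictT _ mT).
by apply: measurable_funTS; exact/measurable_EFinP.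
Qed.

Let f0 p : (0 <= f p)%E.
Proof.
by rewrite /f patchE; case: ifPn => // /set_mem[Dx Dy xy];
   rewrite lee_fin; case: p Dx Dy xy => x y; exact: h0.
Qed.

(** Tonelli's theorem for [h] extended by 0 outside the triangle. It reverses the order of
    integration both in the Gamma-Beta identity and in the semigroup law. *)
Lemma triangle_tonelli :
  (\int[mu]_(x in D) \int[mu]_(y in D `&` [set y | (x < y)%R]) (h (x, y))%:E =
   \int[mu]_(y in D) \int[mu]_(x in D `&` [set x | (x < y)%R]) (h (x, y))%:E)%E.
Proof.
rewrite integral_mkcond [RHS]integral_mkcond.
transitivity (\int[mu]_x \int[mu]_y f (x, y))%E.
  apply: eq_integral => x _; rewrite patchE; case: ifPn => xD.
    rewrite integral_mkcond; apply: eq_integral => y _.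
    rewrite /f !patchE; congr (if _ then _ else _).
    by apply/idP/idP; rewrite !inE /T /= => -[]//; split=> //; exact: set_mem.
  rewrite integral0_eq// => y _; rewrite /f patchE memNset// => -[/= Dx].
  by move/negP: xD; rewrite inE.
transitivity (\int[mu]_y \int[mu]_x f (x, y))%E; first exact: fubini_tonelli.
apply: eq_integral => y _.
rewrite patchE; case: ifPn => yD.
  rewrite [RHS]integral_mkcond; apply: eq_integral => x _.
  rewrite /f !patchE; congr (if _ then _ else _).
  by apply/idP/idP; rewrite !inE /T /= => -[]//; split=> //; exact: set_mem.
rewrite integral0_eq// => x _; rewrite /f patchE memNset// => -[/= _ Dy].
by move/negP: yD; rewrite inE.
Qed.

(** Yields the measurability of a Hadamard integral as a function of its upper limit. *)
Lemma measurable_triangle :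
  measurable_fun D (fun y => \int[mu]_(x in D `&` [set x | (x < y)%R]) (h (x, y))%:E)%E.
Proof.
have := measurable_fun_fubini_tonelli_G f mf f0 (m1 := mu).
move=> /(@measurable_funTS _ _ _ _ D).
apply: eq_measurable_fun => y /set_mem yD; rewrite /fubini_G.
rewrite [RHS]integral_mkcond; apply: eq_integral => x _.
rewrite /f !patchE; congr (if _ then _ else _).
by apply/idP/idP; rewrite !inE /T /= => -[].
Qed.

End triangle.

Definition beta_integral a b : \bar R :=
  \int[mu]_(v in `]0%R, 1%R[) ((1 - v) `^ (a - 1) * v `^ (b - 1))%:E.

(* [Gamma] before taking [fine]: Tonelli's theorem applies to it although its
   finiteness is only a consequence of the Beta identity. *)
Definition gamma_integral a : \bar R :=
  \int[mu]_(s in `]0%R, +oo[) (s `^ (a - 1) * expR (- s))%:E.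

Lemma continuous_powRl c x : 0 < x -> {for x, continuous (@powR R ^~ c)}.
Proof.
move=> x0; apply/differentiable_continuous/derivable1_diffP.
by apply: derivable_powR; rewrite in_itv/= andbT.
Qed.

(** Under [s = r * expR (w * v)] both logarithms become linear in [v] and [ds / s = w dv]. The
    identity holds in [\bar R] for all real [a] and [b]. *)
Lemma ln_div_beta_integral a b r t : 0 < r -> r < t ->
  (\int[mu]_(s in `]r, t[) (ln (t / s) `^ (a - 1) * ln (s / r) `^ (b - 1) / s)%:E
   = beta_integral a b * (ln (t / r) `^ (a + b - 1))%:E)%E.
Proof.
move=> r0 rt; set w := ln (t / r).
have t0 : 0 < t by exact: lt_trans rt.
have w0 : 0 < w by rewrite ln_gt0// ltr_pdivlMr// mul1r.
pose F v := r * expR (w * v).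
have F0 v : 0 < F v by rewrite mulr_gt0 ?expR_gt0.
have lnF v : ln (F v / r) = w * v.
  by rewrite /F mulrC mulKf ?gt_eqF// expRK.
have lnF' v : ln (t / F v) = w * (1 - v).
  have -> : t / F v = t / r * expR (- (w * v)) by rewrite /F expRN invfM mulrA.
  by rewrite lnM ?posrE ?divr_gt0 ?expR_gt0// expRK -/w mulrBr mulr1.
have rw : r * expR w = t.
  by rewrite /w lnK ?posrE ?divr_gt0// mulrC divfK ?gt_eqF.
have Fim : F @` `]0, 1[ = `]r, t[%classic.
  apply/seteqP; split=> [_ [v + <-]|y].
    rewrite /= !in_itv/= => /andP[v0 v1]; apply/andP; split.
      by rewrite /F ltr_pMr// -expR0 ltr_expR mulr_gt0.
    by rewrite -[ltRHS]rw /F ltr_pM2l// ltr_expR gtr_pMr.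
  rewrite /= in_itv/= => /andP[ry yt].
  have y0 : 0 < y by exact: lt_trans ry.
  exists (ln (y / r) / w).
    rewrite /= in_itv/= divr_gt0 ?ln_gt0 ?ltr_pdivlMr ?mul1r//=.
    by rewrite ltr_pdivrMr// mul1r ltr_ln ?posrE ?divr_gt0// ltr_pM2r ?invr_gt0.
  by rewrite /F mulrCA divff ?gt_eqF// mulr1 lnK ?posrE ?divr_gt0// mulrC divfK ?gt_eqF.
have dF v : 0 < v < 1 -> is_derive v (1 : R) F (w * F v).
  move=> _; rewrite /F; apply: is_derive_eq.
  by rewrite /GRing.scale/= mulr1; ring.
have Finc : {in `]0, 1[%classic &, {homo F : x y / x < y}}.
  by move=> x y _ _ xy; rewrite /F ltr_pM2l// ltr_expR ltr_pM2l.
rewrite -Fim (ge0_integration_by_substitution01 Finc dF); last first.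
- move=> v _; rewrite mulr_ge0 ?invr_ge0 ?(ltW (F0 _))// mulr_ge0 ?powR_ge0//.
- move=> v /andP[v0 v1].
  have l1 : 0 < ln (F v / r) by rewrite lnF mulr_gt0.
  have l2 : 0 < ln (t / F v) by rewrite lnF' mulr_gt0// subr_gt0.
  apply: (@continuousM R R (fun s => ln (t / s) `^ (a - 1) * ln (s / r) `^ (b - 1)));
    last by apply: inv_continuous; rewrite gt_eqF.
  apply: (@continuousM R R (fun s => ln (t / s) `^ (a - 1))).
    apply: (@continuous_comp _ _ _ (fun s => ln (t / s)) (@powR R ^~ _));
      last exact: continuous_powRl.
    apply: (@continuous_comp _ _ _ (fun s => t / s) (@ln R)).
      by apply: continuousM; [exact: cst_continuous|apply: inv_continuous; rewrite gt_eqF].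
    by apply: continuous_ln; rewrite divr_gt0.
  apply: (@continuous_comp _ _ _ (fun s => ln (s / r)) (@powR R ^~ _));
    last exact: continuous_powRl.
  apply: (@continuous_comp _ _ _ (fun s => s / r) (@ln R)).
    by apply: continuousM; [exact: cvg_id|exact: cst_continuous].
  by apply: continuous_ln; rewrite divr_gt0.
- by move=> v _; rewrite mulr_ge0 ?ltW.
- move=> v _; apply: (@continuousM R R (cst w) F); first exact: cst_continuous.
  apply: (@continuousM R R (cst r)); first exact: cst_continuous.
  apply: (@continuous_comp _ _ _ (fun v => w * v) expR); last exact: continuous_expR.
  by apply: continuousM; [exact: cst_continuous|exact: cvg_id].
rewrite /beta_integral -ge0_integralZr//=; last 3 first.
- apply/measurable_EFinP; apply: measurable_funM; last first.
    by apply: measurable_funTS; exact: measurable_powR.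
  apply: (@measurableT_comp _ _ _ _ _ _ (@powR R ^~ (a - 1))); first exact: measurable_powR.
  exact: measurable_funB.
- by move=> v _; rewrite lee_fin mulr_ge0 ?powR_ge0.
- by rewrite lee_fin powR_ge0.
apply: eq_integral => v /[!inE] /=; rewrite in_itv/= => /andP[v0 v1].
rewrite -EFinM lnF lnF' !powRM ?ltW ?subr_gt0//.
congr EFin.
have -> : a + b - 1 = (a - 1) + (b - 1) + 1 by ring.
have wn0 : w != 0 by rewrite gt_eqF.
move: (a - 1) (b - 1) => p q.
rewrite !powRD ?wn0 ?implybT// powRr1 ?(ltW w0)//.
by field; rewrite gt_eqF.
Qed.

Lemma beta_integral_scale a b w : 0 < w ->
  (\int[mu]_(r in `]0%R, w[) ((w - r) `^ (a - 1) * r `^ (b - 1))%:E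
   = beta_integral a b * (w `^ (a + b - 1))%:E)%E.
Proof.
move=> w0.
pose F v := w * v.
have Fim : F @` `]0, 1[ = `]0, w[%classic.
  apply/seteqP; split=> [_ [v + <-]|y].
    by rewrite /= !in_itv/= => /andP[v0 v1]; rewrite /F mulr_gt0//= gtr_pMr.
  rewrite /= in_itv/= => /andP[y0 yw].
  exists (y / w); first by rewrite /= in_itv/= divr_gt0//= ltr_pdivrMr// mul1r.
  by rewrite /F mulrC divfK ?gt_eqF.
have dF v : 0 < v < 1 -> is_derive v (1 : R) F (cst w v).
  move=> _; rewrite /F; apply: is_derive_eq.
  by rewrite /GRing.scale/= mulr1.
have Finc : {in `]0, 1[%classic &, {homo F : x y / x < y}}.
  by move=> x y _ _ xy; rewrite /F ltr_pM2l.
rewrite -Fim (ge0_integration_by_substitution01 Finc dF); last first.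
- by move=> v _; rewrite mulr_ge0 ?powR_ge0.
- move=> v /andP[v0 v1].
  apply: (@continuousM R R (fun s => (w - s) `^ (a - 1))).
    apply: (@continuous_comp _ _ _ (fun s => w - s) (@powR R ^~ _)).
      by apply: continuousB; [exact: cst_continuous|exact: cvg_id].
    by apply: continuous_powRl; rewrite subr_gt0 /F gtr_pMr.
  by apply: continuous_powRl; rewrite mulr_gt0.
- by move=> v _; rewrite ltW.
- by move=> v _; exact: cst_continuous.
rewrite /beta_integral -ge0_integralZr//=; last 3 first.
- apply/measurable_EFinP; apply: measurable_funM; last first.
    by apply: measurable_funTS; exact: measurable_powR.
  apply: (@measurableT_comp _ _ _ _ _ _ (@powR R ^~ (a - 1))); first exact: measurable_powR.
  exact: measurable_funB.
- by move=> v _; rewrite lee_fin mulr_ge0 ?powR_ge0.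
- by rewrite lee_fin powR_ge0.
apply: eq_integral => v /[!inE] /=; rewrite in_itv/= => /andP[v0 v1].
have -> : w - F v = w * (1 - v) by rewrite /F; ring.
rewrite -EFinM /F !powRM ?ltW ?subr_gt0//.
congr EFin.
have -> : a + b - 1 = (a - 1) + (b - 1) + 1 by ring.
have wn0 : w != 0 by rewrite gt_eqF.
move: (a - 1) (b - 1) => p q.
rewrite !powRD ?wn0 ?implybT// powRr1 ?(ltW w0)//.
by field.
Qed.

Lemma gamma_integral_shift a r :
  (\int[mu]_(w in `]r, +oo[) ((w - r) `^ (a - 1) * expR (- w))%:E
   = gamma_integral a * (expR (- r))%:E)%E.
Proof.
pose F s := r + s.
have Fim : F @` `]0, +oo[ = [set` (Interval (BRight r) +oo%O : interval R)].
  apply/seteqP; split=> [_ [v + <-]|y].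
    by rewrite /= !in_itv/= !andbT /F ltrDl.
  rewrite /= in_itv/= andbT => ry.
  by exists (y - r); rewrite /= ?in_itv/= ?subr_gt0 ?ry// /F addrC subrK.
have dF v : 0 < v -> is_derive v (1 : R) F (cst 1 v).
  move=> _; rewrite /F; apply: is_derive_eq.
  by rewrite add0r mulr1.
have Finc : {in `]0, +oo[%classic &, {homo F : x y / x < y}}.
  by move=> x y _ _ xy; rewrite /F ltrD2l.
rewrite -Fim (ge0_integration_by_substitution0y Finc dF); last first.
- by move=> v _; rewrite mulr_ge0 ?powR_ge0// expR_ge0.
- move=> v v0.
  apply: (@continuousM R R (fun s => (s - r) `^ (a - 1))).
    apply: (@continuous_comp _ _ _ (fun s => s - r) (@powR R ^~ _)).
      by apply: continuousB; [exact: cvg_id|exact: cst_continuous].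
    by apply: continuous_powRl; rewrite /F addrC addKr.
  apply: (@continuous_comp _ _ _ -%R expR); first exact: continuousN.
  exact: continuous_expR.
- by [].
- by move=> v _; exact: cst_continuous.
rewrite /gamma_integral -ge0_integralZr//=; last 2 first.
- apply/measurable_EFinP; apply: measurable_funM.
    by apply: measurable_funTS; exact: measurable_powR.
  by apply: measurable_funTS; exact: measurableT_comp.
- by move=> v _; rewrite lee_fin mulr_ge0 ?powR_ge0// expR_ge0.
apply: eq_integral => v _.
have -> : F v - r = v by rewrite /F; ring.
by rewrite -EFinM mulr1 /F opprD expRD; congr EFin; ring.
Qed.

(** The substitution [u = v ^ (1 / a)] makes the integrand constant. *)
Lemma powR01_integral a : 0 < a ->
  (\int[mu]_(u in `]0%R, 1%R[) (u `^ (a - 1))%:E = (a^-1)%:E)%E.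
Proof.
move=> a0.
pose F v := v `^ a^-1; pose F' v := a^-1 * v `^ (a^-1 - 1).
have Fim : F @` `]0, 1[ = `]0, 1[%classic.
  have H c v : 0 < c -> 0 < v < 1 -> 0 < v `^ c < 1.
    move=> c0 /andP[v0 v1]; have e1 : (1 : R) `^ c = 1 by rewrite powR1.
    rewrite powR_gt0//= -[ltRHS]e1.
    by rewrite gt0_ltr_powR ?nnegrE// ltW.
  apply/seteqP; split=> [_ [v + <-]|y].
    by rewrite /= !in_itv/=; apply: H; rewrite invr_gt0.
  rewrite /= in_itv/= => y01; exists (y `^ a); first by rewrite /= in_itv/= H.
  by rewrite /F -powRrM divff ?gt_eqF// powRr1// ltW; case/andP: y01.
have dF v : 0 < v < 1 -> is_derive v (1 : R) F (F' v).
  by move=> /andP[v0 _]; exact: is_derive1_powR.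
have Finc : {in `]0, 1[%classic &, {homo F : x y / x < y}}.
  move=> x y; rewrite !inE/= !in_itv/= => /andP[x0 _] /andP[y0 _] xy.
  by rewrite /F gt0_ltr_powR ?nnegrE ?invr_gt0// ltW.
rewrite -{1}Fim (ge0_integration_by_substitution01 Finc dF); last first.
- by move=> v _; rewrite powR_ge0.
- by move=> v /andP[v0 _]; apply: continuous_powRl; rewrite powR_gt0.
- by move=> v _; rewrite mulr_ge0 ?powR_ge0// invr_ge0 ltW.
- move=> v /andP[v0 _]; apply: (@continuousM R R (cst a^-1)); first exact: cst_continuous.
  exact: continuous_powRl.
rewrite (eq_integral (cst (a^-1)%:E)).
  by rewrite integral_cst//= lebesgue_measure_itv/= lte_fin ltr01 oppr0 adde0 mule1.
move=> v /[!inE] /=; rewrite in_itv/= => /andP[v0 v1].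
rewrite /F /F' -powRrM mulrCA -powRD; last by rewrite (gt_eqF v0) implybT.
rewrite (_ : a^-1 * (a - 1) + (a^-1 - 1) = 0) ?powRr0 ?mulr1//.
by field; rewrite gt_eqF.
Qed.

(** This is the total mass of the exponential distribution of rate 1. *)
Lemma gamma_integral1 : gamma_integral (1 : R) = 1%E.
Proof.
have := integral_exponential_pdf (R := R) ltr01.
rewrite /gamma_integral /exponential_pdf => H.
rewrite integral_itv_obnd_cbnd; last first.
  apply/measurable_EFinP; apply: measurable_funM.
    by apply: measurable_funTS; exact: measurable_powR.
  by apply: measurable_funTS; exact: measurableT_comp.
rewrite -H [LHS]integral_mkcond; apply: eq_integral => x _.
rewrite !patchE; case: ifPn => // _.
by rewrite subrr powRr0 mulN1r.
Qed.

Let mp c : measurable_fun [set: R] (fun s => s `^ c * expR (- s)).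
Proof.
by apply: measurable_funM; [exact: measurable_powR|exact: measurableT_comp].
Qed.

(** On []0, 1[] the exponential is at most 1 and the power has integral [1 / a]; on [[1, +oo[] the
    power is at most 1 because [a <= 1]. *)
Lemma gamma_integral_fin_le1 a : 0 < a <= 1 -> (gamma_integral a < +oo)%E.
Proof.
move=> /andP[a0 a1].
rewrite /gamma_integral (@itv_bndbnd_setU _ _ (BRight 0) (BLeft 1)) ?bnd_simp//.
rewrite ge0_integral_setU//=; last 3 first.
- by apply/measurable_EFinP; exact: (measurable_funTS (mp _)).
- by move=> x _; rewrite lee_fin mulr_ge0 ?powR_ge0 ?expR_ge0.
- apply/disj_set2P; rewrite -subset0 => z /= []; rewrite !in_itv/= => /andP[_ z1].
  by rewrite andbT leNgt z1.
apply: lte_add_pinfty.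
- apply: (@le_lt_trans _ _ (\int[mu]_(s in `]0%R, 1%R[) (s `^ (a - 1))%:E)%E).
    apply: ge0_le_integral => //.
    + by move=> x _; rewrite lee_fin mulr_ge0 ?powR_ge0 ?expR_ge0.
    + by apply/measurable_EFinP; exact: (measurable_funTS (mp _)).
    + by apply/measurable_EFinP; apply: measurable_funTS; exact: measurable_powR.
    + move=> x /=; rewrite in_itv/= => /andP[x0 _]; rewrite lee_fin.
      by rewrite ler_piMr ?powR_ge0// -expR0 ler_expR oppr_le0 ltW.
  by rewrite powR01_integral// ltry.
apply: (@le_lt_trans _ _ (gamma_integral 1)); last by rewrite gamma_integral1 ltry.
apply: (@le_trans _ _ (\int[mu]_(s in `[1%R, +oo[) (s `^ (1 - 1) * expR (- s))%:E)%E).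
  apply: ge0_le_integral => //.
  + by move=> x _; rewrite lee_fin mulr_ge0 ?powR_ge0 ?expR_ge0.
  + by apply/measurable_EFinP; exact: (measurable_funTS (mp _)).
  + by apply/measurable_EFinP; exact: (measurable_funTS (mp _)).
  + move=> x /=; rewrite in_itv/= andbT => x1; rewrite lee_fin ler_wpM2r ?expR_ge0//.
    by rewrite ler_powR//; lra.
apply: ge0_subset_integral => //=.
+ by apply/measurable_EFinP; exact: (measurable_funTS (mp _)).
+ by move=> x _; rewrite lee_fin mulr_ge0 ?powR_ge0 ?expR_ge0.
+ by move=> x /=; rewrite !in_itv/= !andbT; apply: lt_le_trans.
Qed.

Lemma gamma_integral_gt0 a : 0 < a -> (0 < gamma_integral a)%E.
Proof.
move=> a0.
(* On [[1, 2]], [s ^ (a - 1) >= 1 / s >= 1 / 2] and [expR (- s) >= expR (- 2)]. *)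
apply: (@lt_le_trans _ _ (\int[mu]_(s in `[1%R, 2%R]) (2^-1 * expR (- 2))%:E)%E).
  rewrite integral_cst//= lebesgue_measure_itv/= lte_fin ltr1n -EFinB -EFinM lte_fin.
  by rewrite !mulr_gt0 ?expR_gt0 ?invr_gt0//; lra.
apply: (@le_trans _ _ (\int[mu]_(s in `[1%R, 2%R]) (s `^ (a - 1) * expR (- s))%:E)%E).
  apply: ge0_le_integral => //.
  + by apply/measurable_EFinP; exact: (measurable_funTS (mp _)).
  + move=> x /=; rewrite in_itv/= => /andP[x1 x2]; rewrite lee_fin.
    apply: ler_pM; rewrite ?expR_ge0 ?invr_ge0//; last by rewrite ler_expR lerN2.
    have x0 : 0 < x by lra.
    apply: (@le_trans _ _ (x `^ (-1))).
      by rewrite powR_inv1 ?(ltW x0)// lef_pV2 ?posrE.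
    by rewrite ler_powR//; lra.
apply: ge0_subset_integral => //=.
+ by apply/measurable_EFinP; exact: (measurable_funTS (mp _)).
+ by move=> x _; rewrite lee_fin mulr_ge0 ?powR_ge0 ?expR_ge0.
+ by move=> x /=; rewrite !in_itv/= !andbT => /andP[]; move=> /(lt_le_trans _) + _; apply.
Qed.

(** [k] ranges over [\bar R] since it will be a Gamma or Beta integral not yet known to be
    finite. *)
Lemma gamma_integralZl (k : \bar R) a : (0 <= k)%E ->
  (k * gamma_integral a =
   \int[mu]_(x in `]0%R, +oo[) (k * (x `^ (a - 1) * expR (- x))%:E))%E.
Proof.
move=> k0; rewrite [RHS]ge0_integralZl//=.
- by apply/measurable_EFinP; exact: (measurable_funTS (mp _)).
- by move=> x _; rewrite lee_fin mulr_ge0 ?powR_ge0 ?expR_ge0.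
Qed.

(** Both sides are the integral of [x ^ (b - 1) * (y - x) ^ (a - 1) * expR (- y)] over [0 < x < y]:
    integrating first in [y] is a shifted Gamma integral, first in [x] a scaled Beta integral. *)
Lemma gamma_beta_integral a b : 0 < a -> 0 < b ->
  (gamma_integral a * gamma_integral b = beta_integral a b * gamma_integral (a + b))%E.
Proof.
move=> a0 b0.
pose h (p : R * R) := p.1 `^ (b - 1) * ((p.2 - p.1) `^ (a - 1) * expR (- p.2)).
have mh : measurable_fun setT h.
  apply: measurable_funM.
    by apply: (measurableT_comp (measurable_powR _)); exact: measurable_fst.
  apply: measurable_funM.
    apply: (measurableT_comp (measurable_powR _)).
    by apply: measurable_funB.
  by apply: measurableT_comp => //; exact: measurableT_comp.
have h0 x y : 0 <= h (x, y) by rewrite !mulr_ge0 ?powR_ge0 ?expR_ge0.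
transitivity (\int[mu]_(x in `]0%R, +oo[)
   \int[mu]_(y in `]0%R, +oo[ `&` [set y | (x < y)%R]) (h (x, y))%:E)%E.
  clear mh h0; have : (0 <= gamma_integral a)%E.
    by apply: integral_ge0 => x _; rewrite lee_fin mulr_ge0 ?powR_ge0 ?expR_ge0.
  have : forall r, (\int[mu]_(w in `]r, +oo[) ((w - r) `^ (a - 1) * expR (- w))%:E
    = gamma_integral a * (expR (- r))%:E)%E by move=> r; exact: gamma_integral_shift.
  move: (gamma_integral a) => ga gaE ga0.
  rewrite (gamma_integralZl _ ga0).
  apply: eq_integral => x /[!inE] /=; rewrite in_itv/= andbT => x0.
  have -> : `]0, +oo[ `&` [set y | x < y] = [set` (Interval (BRight x) +oo%O : interval R)].
    apply/seteqP; split=> y /=; rewrite !in_itv/= !andbT; first by case.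
    by move=> xy; split=> //; exact: lt_trans xy.
  rewrite /h /=; under eq_integral do rewrite EFinM.
  rewrite ge0_integralZl//=; last 3 first.
  - apply/measurable_EFinP; apply: measurable_funTS; apply: measurable_funM.
      apply: (measurableT_comp (measurable_powR _)); exact: measurable_funB.
    exact: measurableT_comp.
  - by move=> y _; rewrite lee_fin mulr_ge0 ?powR_ge0 ?expR_ge0.
  - by rewrite lee_fin powR_ge0.
  by rewrite gaE EFinM muleCA.
rewrite (triangle_tonelli (measurable_itv `]0, +oo[) mh (fun x y _ _ _ => h0 x y)).
clear mh h0.
have : (0 <= beta_integral a b)%E.
  by apply: integral_ge0 => x _; rewrite lee_fin mulr_ge0 ?powR_ge0.
have := beta_integral_scale a b.
move: (beta_integral a b) => be beE be0.
rewrite (gamma_integralZl _ be0).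
apply: eq_integral => y /[!inE] /=; rewrite in_itv/= andbT => y0.
have -> : `]0, +oo[ `&` [set x | x < y] = `]0, y[%classic.
  apply/seteqP; split=> x /=; rewrite !in_itv/= !andbT; first by case=> ->.
  by move=> /andP[].
rewrite /h /=.
under eq_integral do rewrite mulrA [_ * expR _]mulrC [X in _ * X]mulrC EFinM.
rewrite ge0_integralZl//=; last 2 first.
- apply/measurable_EFinP; apply: measurable_funTS; apply: measurable_funM; last first.
    exact: measurable_powR.
  apply: (measurableT_comp (measurable_powR _)); exact: measurable_funB.
- by move=> x _; rewrite lee_fin mulr_ge0 ?powR_ge0.
by rewrite beE// EFinM muleCA [X in (_ * X)%E]muleC.
Qed.

(* Gamma (c / 2) ^+ 2 = B * Gamma c with B > 0 reduces finiteness at c to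
   finiteness at c / 2. *)
Lemma gamma_integral_fin a : 0 < a -> (gamma_integral a < +oo)%E.
Proof.
have H n c : 0 < c -> c <= 2 ^+ n -> (gamma_integral c < +oo)%E.
  elim: n c => [|n IH] c c0 cn.
    by apply: gamma_integral_fin_le1; rewrite c0.
  have c20 : 0 < c / 2 by lra.
  have := gamma_beta_integral c20 c20.
  have g0 := gamma_integral_gt0 c0.
  have g20 := gamma_integral_gt0 c20.
  have g2y : (gamma_integral (c / 2) < +oo)%E.
    by apply: IH => //; rewrite ler_pdivrMr// -exprSr.
  have -> : c / 2 + c / 2 = c by field.
  have : (0 <= beta_integral (c / 2) (c / 2))%E.
    by apply: integral_ge0 => x _; rewrite lee_fin mulr_ge0 ?powR_ge0.
  move=> be0 GB; rewrite ltey; apply/eqP => gcy; move: GB be0; rewrite gcy.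
  (* If the integral at [c] were infinite, the product would be 0 or [+oo] according to whether the
     Beta integral is 0 or positive; but it is the square of the positive real [r]. *)
  case: (gamma_integral (c / 2)) g20 g2y => [r| |] //=.
  rewrite lte_fin => r0 _ + be0; move: be0; rewrite le_eqVlt => /predU1P[<-|b0].
    by rewrite mul0e -EFinM => -[] /eqP; rewrite mulf_eq0 !gt_eqF.
  by rewrite gt0_muley.
move=> a0; apply: (H (Num.trunc a).+1) => //.
apply: (le_trans (ltW (truncnS_gt a))); rewrite -natrX ler_nat.
exact/ltnW/ltn_expl.
Qed.

(** An infinite Beta integral times a positive Gamma integral cannot equal a finite product. *)
Lemma beta_integral_fin a b : 0 < a -> 0 < b -> (beta_integral a b < +oo)%E.
Proof.
move=> a0 b0; have := gamma_beta_integral a0 b0.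
have := gamma_integral_fin a0; have := gamma_integral_fin b0.
have := gamma_integral_gt0 a0; have := gamma_integral_gt0 b0.
have := gamma_integral_gt0 (addr_gt0 a0 b0).
move=> g0 ga0 gb0 gay gby E; rewrite ltey; apply/eqP => beE; move: E ga0 gb0 gay gby.
rewrite beE gt0_mulye//.
by case: (gamma_integral a) => [r| |] //=; case: (gamma_integral b).
Qed.

Lemma Gamma_gt0 a : 0 < a -> 0 < Gamma a.
Proof.
move=> a0; rewrite /Gamma /Rintegral -/(gamma_integral a) fine_gt0//.
by rewrite gamma_integral_gt0//= gamma_integral_fin.
Qed.

Lemma Gamma1 : Gamma (1 : R) = 1.
Proof. by rewrite /Gamma /Rintegral -/(gamma_integral 1) gamma_integral1. Qed.

Lemma beta_integralE a b : 0 < a -> 0 < b ->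
  beta_integral a b = (Gamma a * Gamma b / Gamma (a + b))%:E.
Proof.
move=> a0 b0; have := gamma_beta_integral a0 b0.
have GE c : 0 < c -> gamma_integral c = (Gamma c)%:E.
  move=> c0; rewrite /Gamma /Rintegral -/(gamma_integral c) fineK//.
  by rewrite ge0_fin_numE ?gamma_integral_fin// ltW// gamma_integral_gt0.
have := Gamma_gt0 (addr_gt0 a0 b0); rewrite !GE ?addr_gt0//.
have : (0 <= beta_integral a b)%E.
  by apply: integral_ge0 => x _; rewrite lee_fin mulr_ge0 ?powR_ge0.
have := beta_integral_fin a0 b0.
case: (beta_integral a b) => [x| |] //= _ _ G0.
by rewrite -!EFinM => -[->]; rewrite mulfK// gt_eqF.
Qed.

End GammaBeta.

(** * The semigroup of Hadamard integrals *)

Section HadamardIntegral.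
Context {R : realType}.
Notation mu := (@lebesgue_measure R).
Implicit Types (a b c r s t u v w x y : R) (f g : R -> R).

(* [Gamma a] times the Hadamard integral, over an open interval in order to
   avoid the conventional value of [0 `^ (a - 1)] at [s = t]. *)
Definition hadamard_raw t1 a f t : R :=
  \int[mu]_(s in `]t1, t[) (ln (t / s) `^ (a - 1) * (f s / s)).

(** A class stable under Hadamard integration. Continuity on the segment would be too much to ask of
    intermediate integrals of order below 1. *)
Definition bounded_measurable t1 t2 f :=
  measurable_fun `]t1, t2[ f /\
  exists M : R, forall s, t1 < s < t2 -> `|f s| <= M.

(** Written with [ln t - ln s] instead of [ln (t / s)], and with [s ^ (-1)] for the inverse, the
    kernel is measurable everywhere; [ln_kernelE] reconciles the two forms. *)
Lemma measurable_ln_sub a (d : measure_display) (T : measurableType d) (f g : T -> R) :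
  measurable_fun setT f -> measurable_fun setT g ->
  measurable_fun setT (fun p => (ln (f p) - ln (g p)) `^ (a - 1)).
Proof.
move=> mf mg; apply: (measurableT_comp (measurable_powR _)).
by apply: measurable_funB; apply: measurableT_comp => //; exact: measurable_ln.
Qed.

Lemma ln_kernelE t1 a f t s : 0 < t1 -> t1 < s -> s < t ->
  (ln t - ln s) `^ (a - 1) * (f s * s `^ (-1)) =
  ln (t / s) `^ (a - 1) * (f s / s).
Proof.
move=> t10 ts st; have s0 : 0 < s by exact: lt_trans ts.
by rewrite ln_div ?posrE// ?(lt_trans s0)// powR_inv1// ltW.
Qed.

Lemma measurable_hadamard_raw_integrand t1 a f t t2 : 0 < t1 -> t <= t2 ->
  measurable_fun `]t1, t2[ f ->
  measurable_fun `]t1, t[ (fun s => ln (t / s) `^ (a - 1) * (f s / s)).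
Proof.
move=> t10 tt2 mf.
apply: (@eq_measurable_fun _ _ _ _ _
    (fun s => (ln t - ln s) `^ (a - 1) * (f s * s `^ (-1)))).
  by move=> s /[!inE] /=; rewrite in_itv/= => /andP[ts st]; apply: ln_kernelE ts st.
apply: measurable_funM.
  by apply: measurable_funTS; apply: measurable_ln_sub.
apply: measurable_funM; last by apply: measurable_funTS; exact: measurable_powR.
by apply: measurable_funS mf => //; apply: subset_itvl; rewrite bnd_simp.
Qed.

Lemma ge0_integralZl_EFin_fun (D : set R) f (k : \bar R) : measurable D ->
  measurable_fun D f -> (forall x, D x -> 0 <= f x) -> (0 <= k)%E ->
  (\int[mu]_(x in D) (k * (f x)%:E) = k * \int[mu]_(x in D) (f x)%:E)%E.
Proof.
move=> mD mf f0 k0; apply: (@ge0_integralZl _ _ _ mu _ mD (EFin \o f)) => //.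
exact/measurable_EFinP.
Qed.

Section nonnegative.
Variables (t1 t2 M : R) (f : R -> R).
Hypotheses (t1_gt0 : 0 < t1) (mf : measurable_fun `]t1, t2[ f).
Hypothesis f0M : forall s, t1 < s < t2 -> 0 <= f s <= M.

(** The integrand is dominated by [M] times the bare kernel, a Beta integral with second parameter
    1. Being finite, the integral is not altered by [fine]. *)
Lemma hadamard_rawE_ge0 a t : 0 < a -> t1 < t <= t2 ->
  (\int[mu]_(s in `]t1, t[) (ln (t / s) `^ (a - 1) * (f s / s))%:E)%E =
    (hadamard_raw t1 a f t)%:E
  /\ hadamard_raw t1 a f t <= M * (Gamma a / Gamma (a + 1) * ln (t / t1) `^ a).
Proof.
move=> a0 /andP[t1t tt2].
have B : (\int[mu]_(s in `]t1, t[) (ln (t / s) `^ (a - 1) * (f s / s))%:E <=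
   (M * (Gamma a / Gamma (a + 1) * ln (t / t1) `^ a))%:E)%E.
  have M0 : 0 <= M.
    have h : t1 < (t1 + t) / 2 < t2 by lra.
    by have /andP[h1 h2] := f0M h; exact: le_trans h2.
  pose K s := ln (t / s) `^ (a - 1) * (cst 1 s / s).
  have K0 s : `]t1, t[%classic s -> 0 <= K s.
    rewrite /= in_itv/= => /andP[ts _].
    by rewrite /K !mulr_ge0 ?powR_ge0// invr_ge0 ltW// (lt_trans t1_gt0).
  have mK : measurable_fun `]t1, t[ K by exact: (@measurable_hadamard_raw_integrand t1 a (cst 1) t t).
  have EK : (\int[mu]_(s in `]t1, t[) (K s)%:E)%E =
      (Gamma a / Gamma (a + 1) * ln (t / t1) `^ a)%:E.
    have := ln_div_beta_integral a 1 t1_gt0 t1t.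
    rewrite beta_integralE// Gamma1 mulr1 addrK -EFinM => <-.
    by apply: eq_integral => s _; rewrite /K subrr powRr0 mulr1 mul1r.
  have f0 s : `]t1, t[%classic s -> 0 <= f s <= M.
    rewrite /= in_itv/= => /andP[ts st]; apply: f0M; rewrite ts (lt_le_trans st)//.
  rewrite EFinM -EK -ge0_integralZl//=; last first.
  - exact/measurable_EFinP.
  apply: ge0_le_integral => //=.
  + move=> s ts; rewrite lee_fin; have /andP[fs0 _] := f0 _ ts.
    rewrite mulr_ge0 ?powR_ge0// divr_ge0//; move: ts; rewrite in_itv/= => /andP[ts _].
    by rewrite ltW// (lt_trans t1_gt0).
  + by apply/measurable_EFinP; exact: measurable_hadamard_raw_integrand mf.
  + by apply/measurable_EFinP; exact: measurable_funM.
  + move=> s ts; rewrite -EFinM lee_fin /K [leRHS]mulrCA ler_wpM2l ?powR_ge0//.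
    have /andP[_ fs0] := f0 _ ts; rewrite mul1r.
    rewrite ler_wpM2r// invr_ge0; move: ts; rewrite in_itv/= => /andP[ts _].
    by rewrite ltW// (lt_trans t1_gt0).
have E : (\int[mu]_(s in `]t1, t[) (ln (t / s) `^ (a - 1) * (f s / s))%:E)%E =
    (hadamard_raw t1 a f t)%:E.
  rewrite /hadamard_raw /Rintegral fineK// ge0_fin_numE ?(le_lt_trans B) ?ltry//.
  apply: integral_ge0 => s /=; rewrite in_itv/= => /andP[ts st]; rewrite lee_fin.
  have /andP[fs0 _] : 0 <= f s <= M by apply: f0M; rewrite ts (lt_le_trans st).
  by rewrite mulr_ge0 ?powR_ge0// divr_ge0// ltW// (lt_trans t1_gt0).
by split=> //; rewrite -lee_fin -E.
Qed.

End nonnegative.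

End HadamardIntegral.

Section HadamardSemigroup.
Context {R : realType}.
Notation mu := (@lebesgue_measure R).
Implicit Types (a b c r s t u v w x y : R) (f g : R -> R).

Section nonnegative.
Variables (t1 t2 M : R) (f : R -> R).
Hypotheses (t1_gt0 : 0 < t1) (mf : measurable_fun `]t1, t2[ f).
Hypothesis f0M : forall s, t1 < s < t2 -> 0 <= f s <= M.

(** The extension by 0 makes [ker] measurable and non-negative on the whole plane, as Tonelli's
    theorem on the triangle requires. *)
Let fT := f \_ `]t1, t2[.

Let mfT : measurable_fun setT fT.
Proof. exact/(measurable_restrictT f (measurable_itv _)). Qed.

Let fTE s : t1 < s < t2 -> fT s = f s.
Proof. by move=> h; rewrite /fT patchE mem_set//= in_itv. Qed.

Let fT0 s : 0 <= fT s.
Proof.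
rewrite /fT patchE; case: ifPn => // /set_mem /=; rewrite in_itv/= => h.
by have /andP[] := f0M h.
Qed.

Let ker b (p : R * R) : R :=
  (ln p.2 - ln p.1) `^ (b - 1) * (fT p.1 * p.1 `^ (-1)).

Let mker b : measurable_fun setT (ker b).
Proof.
apply: measurable_funM; first exact: measurable_ln_sub.
apply: measurable_funM; first exact: measurableT_comp.
by apply: (measurableT_comp (measurable_powR _)).
Qed.

Let ker0 b x y : 0 <= ker b (x, y).
Proof. by rewrite /ker !mulr_ge0 ?powR_ge0. Qed.

Let setI_lt t s : t1 < s < t ->
  `]t1, t[ `&` [set r | (r < s)%R] = `]t1, s[%classic.
Proof.
move=> /andP[_ st].
apply/seteqP; split=> r /=; rewrite !in_itv/=; first by case=> /andP[->].
by move=> /andP[tr rs]; split=> //; rewrite tr (lt_trans rs).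
Qed.

Let ker_hadamard_raw b s t : 0 < b -> t1 < s < t -> t <= t2 ->
  (\int[mu]_(r in `]t1, t[ `&` [set r | (r < s)%R]) (ker b (r, s))%:E)%E =
  (hadamard_raw t1 b f s)%:E.
Proof.
move=> b0 /andP[ts st] tt2; rewrite setI_lt ?ts//.
have ts2 : t1 < s <= t2 by rewrite ts (le_trans (ltW st)).
have [<- _] := hadamard_rawE_ge0 t1_gt0 mf f0M b0 ts2.
apply: eq_integral => r /[!inE] /=; rewrite in_itv/= => /andP[tr rs].
rewrite -(ln_kernelE _ _ t1_gt0 tr rs) /ker/= fTE// tr.
by rewrite (lt_trans rs)// (lt_le_trans st).
Qed.

Lemma measurable_hadamard_raw_ge0 b : 0 < b -> measurable_fun `]t1, t2[ (hadamard_raw t1 b f).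
Proof.
move=> b0; apply/measurable_EFinP.
have := measurable_triangle (measurable_itv `]t1, t2[) (mker b)
  (fun x y _ _ _ => ker0 b x y).
apply: eq_measurable_fun => s /[!inE] /=; rewrite in_itv/= => ts.
exact: ker_hadamard_raw.
Qed.

(** Reverse the order of integration over [t1 < r < s < t]; for fixed [r] the integral in [s] over
    []r, t[] is the logarithmic Beta integral. *)
Lemma hadamard_raw_hadamard_raw_ge0 a b t : 0 < a -> 0 < b -> t1 < t <= t2 ->
  hadamard_raw t1 a (hadamard_raw t1 b f) t =
  Gamma a * Gamma b / Gamma (a + b) * hadamard_raw t1 (a + b) f t.
Proof.
move=> a0 b0 /andP[t1t tt2].
have [Eab _] := hadamard_rawE_ge0 t1_gt0 mf f0M (addr_gt0 a0 b0) (introT andP (conj t1t tt2)).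
suff : (\int[mu]_(s in `]t1, t[) (ln (t / s) `^ (a - 1) * (hadamard_raw t1 b f s / s))%:E =
    beta_integral a b * (hadamard_raw t1 (a + b) f t)%:E)%E.
  by rewrite beta_integralE// -EFinM => /(congr1 fine).
pose h p := ((ln t - ln p.2) `^ (a - 1) * p.2 `^ (-1)) * ker b p.
have mh : measurable_fun setT h.
  apply: measurable_funM => //; apply: measurable_funM.
    by apply: measurable_ln_sub.
  by apply: (measurableT_comp (measurable_powR _)).
have h0 x y : 0 <= h (x, y) by rewrite !mulr_ge0 ?powR_ge0 ?ker0.
have E := triangle_tonelli (measurable_itv `]t1, t[) mh (fun x y _ _ _ => h0 x y).
have pos s : t1 < s -> 0 < s by exact: lt_trans.
transitivity (\int[mu]_(y in `]t1, t[)
    \int[mu]_(x in `]t1, t[ `&` [set x | (x < y)%R]) (h (x, y))%:E)%E.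
  clear E mh h0; apply: eq_integral => s /[!inE] /=; rewrite in_itv/= => /andP[ts st].
  have hs : t1 < s < t by rewrite ts.
  rewrite /h /=; under eq_integral do rewrite EFinM.
  rewrite ge0_integralZl//=; last 4 first.
  - by rewrite setI_lt.
  - apply/measurable_EFinP; apply: measurable_funTS.
    by apply: (measurableT_comp (mker b)); exact: measurable_fun_pair.
  - by move=> r _; rewrite lee_fin.
  - by rewrite lee_fin mulr_ge0 ?powR_ge0.
  rewrite ker_hadamard_raw// -EFinM; congr EFin.
  by rewrite ln_div ?posrE ?pos// ?(lt_trans ts)// powR_inv1 ?ltW ?pos//; ring.
rewrite -E -Eab; transitivity (\int[mu]_(r in `]t1, t[)
  (beta_integral a b * (ln (t / r) `^ (a + b - 1) * (f r / r))%:E))%E; last first.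
  clear E mh h0; apply: ge0_integralZl_EFin_fun => //.
  - exact: measurable_hadamard_raw_integrand mf.
  - move=> s; rewrite /= in_itv/= => /andP[ts st].
    have /andP[fs _] : 0 <= f s <= M by apply: f0M; rewrite ts (lt_le_trans st).
    by rewrite mulr_ge0 ?powR_ge0// divr_ge0// ltW// pos.
  - by apply: integral_ge0 => x _; rewrite lee_fin mulr_ge0 ?powR_ge0.
clear E mh h0; apply: eq_integral => r /[!inE] /=; rewrite in_itv/= => /andP[tr rt].
have r0 := pos _ tr.
have -> : `]t1, t[ `&` [set s | (r < s)%R] = `]r, t[%classic.
  apply/seteqP; split=> s /=; rewrite !in_itv/=; first by case=> /andP[_ ->] ->.
  by move=> /andP[rs st]; split=> //; rewrite st (lt_trans tr).
have -> : (ln (t / r) `^ (a + b - 1) * (f r / r))%:E =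
   ((f r / r)%:E * (ln (t / r) `^ (a + b - 1))%:E)%E by rewrite -EFinM mulrC.
rewrite muleCA -(ln_div_beta_integral a b r0 rt).
transitivity (\int[mu]_(s in `]r, t[) ((f r / r)%:E *
    (ln (t / s) `^ (a - 1) * ln (s / r) `^ (b - 1) / s)%:E))%E; last first.
  apply: ge0_integralZl_EFin_fun => //.
  - apply: (@eq_measurable_fun _ _ _ _ _ (fun s => (ln t - ln s) `^ (a - 1) *
        (ln s - ln r) `^ (b - 1) * s `^ (-1))).
      move=> s /[!inE] /=; rewrite in_itv/= => /andP[rs st].
      have s0 : 0 < s by exact: lt_trans rs.
      by rewrite !ln_div ?posrE// ?powR_inv1 ?(ltW s0)// (lt_trans s0).
    apply: measurable_funTS; apply: measurable_funM; last exact: measurable_powR.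
    by apply: measurable_funM; apply: measurable_ln_sub.
  - move=> s; rewrite /= in_itv/= => /andP[rs st].
    by rewrite !mulr_ge0 ?powR_ge0// invr_ge0 ltW// (lt_trans r0).
  - have /andP[fs _] : 0 <= f r <= M by apply: f0M; rewrite tr (lt_le_trans rt).
    by rewrite lee_fin divr_ge0// ltW.
apply: eq_integral => s /[!inE] /=; rewrite in_itv/= => /andP[rs st].
have s0 : 0 < s by exact: lt_trans rs.
have t0 : 0 < t by exact: lt_trans st.
rewrite -EFinM; congr EFin; rewrite /h /ker/= fTE ?tr ?(lt_le_trans rt)//.
rewrite !ln_div ?posrE// !powR_inv1 ?(ltW s0) ?(ltW r0)//; ring.
Qed.

End nonnegative.

End HadamardSemigroup.

(** * Bounded integrands of arbitrary sign *)

Section HadamardSigned.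
Context {R : realType}.
Notation mu := (@lebesgue_measure R).
Implicit Types (a b c r s t u v w x y M : R) (f g : R -> R).

Lemma bounded_measurable_cst t1 t2 c : bounded_measurable t1 t2 (cst c).
Proof. by split; [exact: measurable_cst|exists `|c|]. Qed.

Lemma bounded_measurableD t1 t2 f g :
  bounded_measurable t1 t2 f -> bounded_measurable t1 t2 g ->
  bounded_measurable t1 t2 (f \+ g).
Proof.
move=> [mf [M fM]] [mg [N gN]]; split; first exact: measurable_funD.
by exists (M + N) => s ts; rewrite (le_trans (ler_normD _ _))// lerD ?fM ?gN.
Qed.

Lemma bounded_measurableM t1 t2 f g :
  bounded_measurable t1 t2 f -> bounded_measurable t1 t2 g ->
  bounded_measurable t1 t2 (f \* g).
Proof.
move=> [mf [M fM]] [mg [N gN]]; split; first exact: measurable_funM.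
by exists (M * N) => s ts; rewrite normrM ler_pM ?fM ?gN.
Qed.

Lemma bounded_measurableB t1 t2 f g :
  bounded_measurable t1 t2 f -> bounded_measurable t1 t2 g ->
  bounded_measurable t1 t2 (f \- g).
Proof.
move=> [mf [M fM]] [mg [N gN]]; split; first exact: measurable_funB.
by exists (M + N) => s ts; rewrite (le_trans (ler_normB _ _))// lerD ?fM ?gN.
Qed.

Lemma hadamard_raw_integrable t1 t2 a f t : 0 < t1 -> bounded_measurable t1 t2 f ->
  0 < a -> t1 < t <= t2 ->
  mu.-integrable `]t1, t[ (EFin \o (fun s => ln (t / s) `^ (a - 1) * (f s / s))).
Proof.
move=> t10 [mf [M fM]] a0 /[dup] ht /andP[t1t tt2].
have pos s : t1 < s -> 0 < s by exact: lt_trans.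
have M0 : 0 <= M.
  have h : t1 < (t1 + t) / 2 < t2 by lra.
  by rewrite (le_trans _ (fM _ h)).
have mK := @measurable_hadamard_raw_integrand R t1 a (cst M) t t2 t10 tt2 (measurable_cst _).
have cM0 s : t1 < s < t2 -> 0 <= cst M s <= M by rewrite /= M0 lexx.
have [E _] := hadamard_rawE_ge0 t10 (measurable_cst _ : measurable_fun `]t1, t2[ (cst M)) cM0 a0 ht.
have K0 s : `]t1, t[%classic s -> 0 <= ln (t / s) `^ (a - 1) * (cst M s / s).
  rewrite /= in_itv/= => /andP[ts _].
  by rewrite mulr_ge0 ?powR_ge0// divr_ge0// ltW// pos.
apply: (@le_integrable _ _ _ mu _ _ _
  (EFin \o (fun s => ln (t / s) `^ (a - 1) * (cst M s / s)))) => //.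
- by apply/measurable_EFinP; exact: measurable_hadamard_raw_integrand mf.
- move=> s ts /=; rewrite lee_fin.
  have := ts; rewrite /= in_itv/= => /andP[t1s st].
  rewrite [leRHS]ger0_norm; last exact: K0.
  rewrite !normrM (ger0_norm (powR_ge0 _ _)) ler_wpM2l ?powR_ge0//.
  rewrite normfV (gtr0_norm (pos _ t1s)) ler_wpM2r// ?invr_ge0 ?(ltW (pos _ t1s))//.
  by rewrite fM// t1s (lt_le_trans st).
apply/integrableP; split; first exact/measurable_EFinP.
apply: (@le_lt_trans _ _
  (\int[mu]_(s in `]t1, t[) (ln (t / s) `^ (a - 1) * (cst M s / s))%:E)%E).
  rewrite le_eqVlt; apply/orP; left; apply/eqP/eq_integral.
  by move=> s /[!inE] ts /=; rewrite ger0_norm// K0.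
by rewrite E ltry.
Qed.

Lemma eq_hadamard_raw t1 a f g t : (forall s, t1 < s < t -> f s = g s) ->
  hadamard_raw t1 a f t = hadamard_raw t1 a g t.
Proof.
by move=> fg; apply: eq_Rintegral => s /[!inE] /=; rewrite in_itv/= => ts; rewrite fg.
Qed.

Lemma hadamard_rawB t1 t2 a f g t : 0 < t1 -> bounded_measurable t1 t2 f ->
  bounded_measurable t1 t2 g -> 0 < a -> t1 < t <= t2 ->
  hadamard_raw t1 a (f \- g) t = hadamard_raw t1 a f t - hadamard_raw t1 a g t.
Proof.
move=> t10 bf bg a0 ht; rewrite /hadamard_raw -RintegralB//;
  [|exact: hadamard_raw_integrable bf _ _|exact: hadamard_raw_integrable bg _ _].
by apply: eq_Rintegral => s _ /=; ring.
Qed.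

Lemma hadamard_rawZ t1 t2 a c f t : 0 < t1 -> bounded_measurable t1 t2 f ->
  0 < a -> t1 < t <= t2 ->
  hadamard_raw t1 a (fun s => c * f s) t = c * hadamard_raw t1 a f t.
Proof.
move=> t10 bf a0 ht; rewrite /hadamard_raw -RintegralZl//;
  last exact: hadamard_raw_integrable bf _ _.
by apply: eq_Rintegral => s _ /=; ring.
Qed.

Lemma hadamard_raw_cst t1 t2 a M t : 0 < t1 -> 0 <= M -> 0 < a -> t1 < t <= t2 ->
  0 <= hadamard_raw t1 a (cst M) t <= M * (Gamma a / Gamma (a + 1) * ln (t / t1) `^ a).
Proof.
move=> t10 M0 a0 ht.
have cM0 s : t1 < s < t2 -> 0 <= cst M s <= M by rewrite /= M0 lexx.
have [E ->] := hadamard_rawE_ge0 t10 (measurable_cst _ : measurable_fun `]t1, t2[ (cst M)) cM0 a0 ht.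
rewrite andbT; apply: Rintegral_ge0 => s /=; rewrite in_itv/= => /andP[t1s _].
by rewrite mulr_ge0 ?powR_ge0// divr_ge0// ltW// (lt_trans t10).
Qed.

(** The bound increases with [t], hence boundedness of the integral, and tends to 0 at [t1], hence
    its limit there. *)
Lemma hadamard_raw_norm_le t1 t2 a f M t : 0 < t1 -> measurable_fun `]t1, t2[ f ->
  (forall s, t1 < s < t2 -> `|f s| <= M) -> 0 < a -> t1 < t <= t2 ->
  `|hadamard_raw t1 a f t| <= M * (Gamma a / Gamma (a + 1) * ln (t / t1) `^ a).
Proof.
move=> t10 mf fM a0 /[dup] ht /andP[t1t tt2].
have bf : bounded_measurable t1 t2 f by split => //; exists M.
have bM := bounded_measurable_cst t1 t2 M.
have pos s : t1 < s -> 0 < s by exact: lt_trans.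
have M0 : 0 <= M.
  have h : t1 < (t1 + t) / 2 < t2 by lra.
  by rewrite (le_trans _ (fM _ h)).
have /andP[_ B] := hadamard_raw_cst t10 M0 a0 ht.
apply: le_trans B; apply: (le_trans (le_normr_Rintegral _ _)) => //.
  exact: hadamard_raw_integrable bf _ _.
apply: le_Rintegral => //.
- by apply: integrable_norm; exact: hadamard_raw_integrable bf _ _.
- exact: hadamard_raw_integrable bM _ _.
move=> s; rewrite /= in_itv/= => /andP[t1s st].
rewrite !normrM (ger0_norm (powR_ge0 _ _)) ler_wpM2l ?powR_ge0//.
rewrite normfV (gtr0_norm (pos _ t1s)) ler_wpM2r// ?invr_ge0 ?(ltW (pos _ t1s))//.
by rewrite fM// t1s (lt_le_trans st).
Qed.

(** Reduces measurability and the semigroup law to non-negative functions, applied to [f + M] and to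
    the constant [M]. *)
Lemma bounded_measurable_split t1 t2 f : t1 < t2 -> bounded_measurable t1 t2 f ->
  exists M, [/\ 0 <= M, measurable_fun `]t1, t2[ (f \+ cst M),
    forall s, t1 < s < t2 -> 0 <= (f \+ cst M) s <= M + M &
    f = (f \+ cst M) \- cst M].
Proof.
move=> t12 [mf [M fM]]; exists M.
have h : t1 < (t1 + t2) / 2 < t2 by lra.
split; first by rewrite (le_trans _ (fM _ h)).
- exact: measurable_funD.
- by move=> s /fM /=; rewrite ler_norml => /andP[]; lra.
- by apply/funext => s /=; rewrite addrK.
Qed.

Lemma bounded_measurable_hadamard_raw t1 t2 b f : 0 < t1 -> bounded_measurable t1 t2 f ->
  0 < b -> bounded_measurable t1 t2 (hadamard_raw t1 b f).
Proof.
move=> t10 bf b0.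
have [t12|t21] := ltP t1 t2; last first.
  have e s : t1 < s < t2 -> False.
    move=> /andP[h1 h2].
    by have := lt_trans h1 h2; rewrite ltNge t21.
  split; last by exists 0 => s /e.
  by rewrite set_itv_ge ?bnd_simp -?leNgt//; exact: measurable_fun_set0.
have [mf [M fM]] := bf; split.
  have [N [N0 mfN fN Ef]] := bounded_measurable_split t12 bf.
  have bN := bounded_measurable_cst t1 t2 N.
  have bfN := bounded_measurableD bf bN.
  have cN0 s : t1 < s < t2 -> 0 <= cst N s <= N by rewrite /= N0 lexx.
  apply: (@eq_measurable_fun _ _ _ _ _
      (hadamard_raw t1 b (f \+ cst N) \- hadamard_raw t1 b (cst N))).
    move=> s /[!inE] /=; rewrite in_itv/= => /andP[ts st].
    by rewrite -(hadamard_rawB t10 bfN bN b0) ?ts ?ltW// -Ef.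
  apply: measurable_funB.
    exact (measurable_hadamard_raw_ge0 t10 mfN fN b0).
  exact (measurable_hadamard_raw_ge0 t10 (measurable_cst _) cN0 b0).
exists (M * (Gamma b / Gamma (b + 1) * ln (t2 / t1) `^ b)) => s /andP[ts st].
have hs : t1 < s <= t2 by rewrite ts ltW.
apply: le_trans (hadamard_raw_norm_le t10 mf fM b0 hs) _.
have M0 : 0 <= M by rewrite (le_trans _ (fM s _))// ts.
rewrite ler_wpM2l// ler_wpM2l ?divr_ge0 ?(ltW (Gamma_gt0 _)) ?addr_gt0//.
have H u : t1 <= u -> 1 <= u / t1 by move=> h; rewrite ler_pdivlMr// mul1r.
rewrite ge0_ler_powR ?nnegrE ?(ltW b0) ?ln_ge0 ?H ?(ltW ts) ?(ltW t12)//.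
have s0 : 0 < s by exact: lt_trans ts.
have t20 : 0 < t2 by exact: lt_trans t12.
by rewrite ler_ln ?posrE ?divr_gt0//; apply: ler_wpM2r; rewrite ?invr_ge0 ltW.
Qed.

Lemma hadamard_raw_hadamard_raw t1 t2 a b f t : 0 < t1 -> bounded_measurable t1 t2 f ->
  0 < a -> 0 < b -> t1 < t <= t2 ->
  hadamard_raw t1 a (hadamard_raw t1 b f) t =
  Gamma a * Gamma b / Gamma (a + b) * hadamard_raw t1 (a + b) f t.
Proof.
move=> t10 bf a0 b0 /[dup] ht /andP[t1t tt2].
have t12 : t1 < t2 by exact: lt_le_trans tt2.
have [N [N0 mfN fN Ef]] := bounded_measurable_split t12 bf.
have bN := bounded_measurable_cst t1 t2 N.
have bfN := bounded_measurableD bf bN.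
have cN0 s : t1 < s < t2 -> 0 <= cst N s <= N by rewrite /= N0 lexx.
have H1 := hadamard_raw_hadamard_raw_ge0 t10 mfN fN a0 b0 ht.
have H2 := hadamard_raw_hadamard_raw_ge0 t10 (measurable_cst _) cN0 a0 b0 ht.
rewrite Ef (hadamard_rawB t10 bfN bN (addr_gt0 a0 b0) ht) mulrBr -H1 -H2.
have bJfN := bounded_measurable_hadamard_raw t10 bfN b0.
have bJN := bounded_measurable_hadamard_raw t10 bN b0.
rewrite -(hadamard_rawB t10 bJfN bJN a0 ht).
apply: eq_hadamard_raw => s /andP[ts st].
by rewrite (hadamard_rawB t10 bfN bN b0)// ts (le_trans (ltW st)).
Qed.

End HadamardSigned.

(** * Order one: the fundamental theorem of calculus *)

Section HadamardOrderOne.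
Context {R : realType}.
Notation mu := (@lebesgue_measure R).
Implicit Types (a b c r s t u v w x y M : R) (f g : R -> R).

Lemma is_derive_0_constant a b f :
  (forall t, a < t < b -> is_derive t (1 : R) f 0) ->
  forall s t, a < s < b -> a < t < b -> f s = f t.
Proof.
move=> df.
suff H s t : a < s < b -> a < t < b -> s < t -> f s = f t.
  move=> s t hs ht; have [st|ts|->//] := ltgtP s t; first exact: H.
  by apply/esym/H.
move=> /andP[as_ sb] /andP[at_ tb] st.
have dst u : s <= u <= t -> is_derive u (1 : R) f 0.
  by move=> /andP[su ut]; apply: df; rewrite (lt_le_trans as_)//= (le_lt_trans ut).
have [||c _] := @MVT R f (cst 0) s t st.
- by move=> u; rewrite in_itv/= => /andP[su ut]; apply: dst; rewrite !ltW.
- apply: continuous_in_subspaceT => u /[!inE] /=; rewrite in_itv/= => /dst d.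
  by apply/differentiable_continuous/derivable1_diffP; have [] := d.
by rewrite mul0r => /eqP; rewrite subr_eq0 => /eqP.
Qed.

Section order_one.
Variables (t1 t2 : R) (f : R -> R).
Hypotheses (t1_gt0 : 0 < t1) (t1_lt_t2 : t1 < t2).
Hypothesis bf : bounded_measurable t1 t2 f.

(** [f] is controlled only on the open interval; cutting off to 0 gives an integrable function on
    the closed segment with the same primitive. *)
Let g := (fun s => f s / s) \_ `]t1, t2[.

Let gE s : t1 < s < t2 -> g s = f s / s.
Proof. by move=> h; rewrite /g patchE mem_set//= in_itv. Qed.

Let ig : mu.-integrable `[t1, t2] (EFin \o g).
Proof.
have t12 : t1 < t2 <= t2 by rewrite t1_lt_t2 lexx.
have := hadamard_raw_integrable t1_gt0 bf ltr01 t12.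
have -> : (fun s => ln (t2 / s) `^ (1 - 1) * (f s / s)) = (fun s => f s / s).
  by apply/funext => s; rewrite subrr powRr0 mul1r.
move=> h; rewrite /g -restrict_EFin; apply/integrable_restrict => //=.
by rewrite setIidr//; exact: subset_itv_oo_cc.
Qed.

Let hadamard_raw1E t : t1 <= t <= t2 -> hadamard_raw t1 1 f t = \int[mu]_(s in `[t1, t]) g s.
Proof.
move=> /andP[t1t tt2].
have mg : measurable_fun `]t1, t[ (EFin \o g).
  apply: (measurable_funS _ _ (measurable_int mu ig)) => //.
  by apply: subset_itv; rewrite bnd_simp.
rewrite /hadamard_raw /Rintegral [in RHS]integral_itv_bndoo//; congr fine.
apply: eq_integral => s /[!inE] /=; rewrite in_itv/= => /andP[ts st].
by rewrite subrr powRr0 mul1r gE// ts (lt_le_trans st).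
Qed.

Lemma hadamard_raw1_is_derive t : t1 < t < t2 -> {for t, continuous f} ->
  is_derive t (1 : R) (hadamard_raw t1 1 f) (f t / t).
Proof.
move=> ht cf; have /andP[t1t tt2] := ht.
have near_t : \forall s \near t, t1 < s < t2.
  by apply: near_in_itvoo; rewrite in_itv.
have cg : {for t, continuous g}.
  rewrite /prop_for /continuous_at gE//.
  apply: (@cvg_trans _ ((f s / s) @[s --> t])).
    apply: near_eq_cvg; near=> s; apply/esym/gE; near: s; exact: near_t.
  apply: (@continuousM R R f (fun s => s^-1)) => //.
  by apply: inv_continuous; rewrite gt_eqF// (lt_trans t1_gt0).
have := continuous_FTC1_closed tt2 ig t1t cg.
move=> [dG GE].
apply: (near_eq_is_derive (f := fun y => \int[mu]_(s in `[t1, y]) g s)).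
  near=> s; apply/esym/hadamard_raw1E.
  have /andP[h1 h2] : t1 < s < t2 by near: s; exact: near_t.
  by rewrite !ltW.
by apply: DeriveDef => //; rewrite -derive1E GE gE.
Unshelve. all: by end_near. Qed.

Lemma hadamard_raw1_continuous : {within `[t1, t2], continuous (hadamard_raw t1 1 f)}.
Proof.
apply: (subspace_eq_continuous (f := fun x => parameterized_integral mu t1 x g)).
  move=> x /[!inE] /=; rewrite in_itv/= => hx.
  by rewrite /= /from_subspace /= hadamard_raw1E.
exact: parameterized_integral_continuous (ltW t1_lt_t2) ig.
Qed.

End order_one.

End HadamardOrderOne.

(** * Normalized Hadamard integrals, order zero included *)

Section HadamardInt.
Context {R : realType}.
Notation mu := (@lebesgue_measure R).
Implicit Types (a b c r s t u v w x y M : R) (f g : R -> R).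

Lemma hadamard_raw_cst1 t1 a t : 0 < t1 -> 0 < a -> t1 < t ->
  hadamard_raw t1 a (cst 1) t = Gamma a / Gamma (a + 1) * ln (t / t1) `^ a.
Proof.
move=> t10 a0 t1t; rewrite /hadamard_raw /Rintegral.
have := ln_div_beta_integral a 1 t10 t1t.
rewrite beta_integralE// Gamma1 mulr1 addrK -EFinM => /(congr1 fine)/= <-; congr fine.
by apply: eq_integral => s _; rewrite subrr powRr0 mulr1 mul1r.
Qed.

Lemma eq_bounded_measurable t1 t2 f g : (forall s, t1 < s < t2 -> f s = g s) ->
  bounded_measurable t1 t2 f -> bounded_measurable t1 t2 g.
Proof.
move=> fg [mf [M fM]]; split; last by exists M => s ts; rewrite -fg// fM.
by apply: eq_measurable_fun mf => s /[!inE] /=; rewrite in_itv => /fg.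
Qed.

Lemma within_continuous_norm t1 t2 f : {within `[t1, t2], continuous f} ->
  {within `[t1, t2], continuous (fun s => `|f s|)}.
Proof. by move=> cf s; apply: continuous_comp; [exact: cf|exact: norm_continuous]. Qed.

Lemma continuous_bounded_measurable t1 t2 f : t1 <= t2 ->
  {within `[t1, t2], continuous f} -> bounded_measurable t1 t2 f.
Proof.
move=> t12 cf; split.
  apply: (@measurable_funS _ _ _ _ `[t1, t2]) => //; first exact: subset_itv_oo_cc.
  exact: subspace_continuous_measurable_fun.
have [c _ fc] := EVT_max t12 (within_continuous_norm cf).
by exists `|f c| => s /andP[ts st]; apply: fc; rewrite in_itv/= !ltW.
Qed.

Lemma hadamard_int0 t1 f : hadamard_int t1 0 f = f.
Proof. by apply/funext => t; rewrite /hadamard_int eqxx. Qed.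

Lemma hadamard_intE t1 t2 a f t : 0 < t1 -> bounded_measurable t1 t2 f ->
  0 < a -> t1 < t <= t2 ->
  hadamard_int t1 a f t = (Gamma a)^-1 * hadamard_raw t1 a f t.
Proof.
move=> t10 [mf _] a0 /andP[t1t tt2]; rewrite /hadamard_int gt_eqF//; congr *%R.
rewrite /hadamard_raw /Rintegral integral_itv_bndoo//.
by apply/measurable_EFinP; exact: measurable_hadamard_raw_integrand mf.
Qed.

Lemma eq_hadamard_int t1 t2 a f g t : 0 < t1 -> bounded_measurable t1 t2 f ->
  (forall s, t1 < s < t2 -> f s = g s) -> 0 < a -> t1 < t <= t2 ->
  hadamard_int t1 a f t = hadamard_int t1 a g t.
Proof.
move=> t10 bf fg a0 /[dup] ht /andP[t1t tt2].
rewrite !(hadamard_intE (t2 := t2))//; last exact: eq_bounded_measurable bf.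
congr *%R; apply: eq_hadamard_raw => s /andP[ts st]; apply: fg.
by rewrite ts (lt_le_trans st).
Qed.

Lemma hadamard_int1 t1 t2 f t : 0 < t1 -> bounded_measurable t1 t2 f ->
  t1 < t <= t2 -> hadamard_int t1 1 f t = hadamard_raw t1 1 f t.
Proof. by move=> t10 bf ht; rewrite (hadamard_intE t10 bf)// Gamma1 invr1 mul1r. Qed.

Lemma hadamard_intB t1 t2 a f g t : 0 < t1 -> bounded_measurable t1 t2 f ->
  bounded_measurable t1 t2 g -> 0 < a -> t1 < t <= t2 ->
  hadamard_int t1 a (f \- g) t = hadamard_int t1 a f t - hadamard_int t1 a g t.
Proof.
move=> t10 bf bg a0 ht.
rewrite (hadamard_intE t10 (bounded_measurableB bf bg))//.
by rewrite (hadamard_intE t10 bf)// (hadamard_intE t10 bg)// (hadamard_rawB t10 bf bg)// mulrBr.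
Qed.

Lemma hadamard_int_cst t1 a c t : 0 < t1 -> 0 < a -> t1 < t ->
  hadamard_int t1 a (cst c) t = c / Gamma (a + 1) * ln (t / t1) `^ a.
Proof.
move=> t10 a0 t1t; have ht : t1 < t <= t by rewrite t1t lexx.
have b1 := bounded_measurable_cst t1 t 1.
rewrite (hadamard_intE t10 (bounded_measurable_cst t1 t c) a0 ht).
rewrite (_ : cst c = (fun s => c * cst 1 s)); last by apply/funext => s /=; rewrite mulr1.
rewrite (hadamard_rawZ _ t10 b1 a0 ht) hadamard_raw_cst1//.
have Ga := Gamma_gt0 a0; have Ga1 := Gamma_gt0 (addr_gt0 a0 ltr01).
move: (Gamma a) (Gamma (a + 1)) (ln (t / t1) `^ a) Ga Ga1 => p q y p0 q0.
by field; rewrite !gt_eqF.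
Qed.

Lemma bounded_measurable_hadamard_int t1 t2 a f : 0 < t1 ->
  bounded_measurable t1 t2 f -> 0 <= a -> bounded_measurable t1 t2 (hadamard_int t1 a f).
Proof.
move=> t10 bf; rewrite le_eqVlt => /predU1P[<-|a0]; first by rewrite hadamard_int0.
apply: (@eq_bounded_measurable _ _ (cst (Gamma a)^-1 \* hadamard_raw t1 a f)).
  by move=> s /andP[ts st]; rewrite (hadamard_intE t10 bf)// ts ltW.
apply: bounded_measurableM; first exact: bounded_measurable_cst.
exact: bounded_measurable_hadamard_raw.
Qed.

(** Order 0 is allowed because [2 - sigma] vanishes for [sigma = 2] and [1 - kappa] for
    [kappa = 1]. *)
Lemma hadamard_int_semigroup t1 t2 a b f t : 0 < t1 -> bounded_measurable t1 t2 f ->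
  0 <= a -> 0 <= b -> t1 < t <= t2 ->
  hadamard_int t1 a (hadamard_int t1 b f) t = hadamard_int t1 (a + b) f t.
Proof.
move=> t10 bf; rewrite le_eqVlt => /predU1P[<-|a0]; first by rewrite hadamard_int0 add0r.
rewrite le_eqVlt => /predU1P[<-|b0] ht; first by rewrite hadamard_int0 addr0.
have bJ := bounded_measurable_hadamard_int t10 bf (ltW b0).
rewrite (hadamard_intE t10 bJ)// (hadamard_intE t10 bf) ?addr_gt0//.
rewrite (@eq_hadamard_raw _ t1 a _ (fun s => (Gamma b)^-1 * hadamard_raw t1 b f s)); last first.
  move=> s /andP[ts st]; rewrite (hadamard_intE t10 bf)// ts.
  by case/andP: ht => _ /(lt_le_trans st)/ltW.
rewrite (hadamard_rawZ _ t10 (bounded_measurable_hadamard_raw t10 bf b0) a0 ht).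
rewrite (hadamard_raw_hadamard_raw t10 bf)//.
have Ga := Gamma_gt0 a0; have Gb := Gamma_gt0 b0; have Gab := Gamma_gt0 (addr_gt0 a0 b0).
move: (Gamma a) (Gamma b) (Gamma (a + b)) (hadamard_raw t1 (a + b) f t) Ga Gb Gab.
by move=> p q r y p0 q0 r0; field; rewrite !gt_eqF.
Qed.

(** Split off one order: the integral of order [a] is an indefinite integral of the one of order
    [a - 1]. *)
Lemma hadamard_int_continuous t1 t2 a f : 0 < t1 -> t1 < t2 ->
  bounded_measurable t1 t2 f -> 1 <= a ->
  {within `[t1, t2], continuous (hadamard_int t1 a f)}.
Proof.
move=> t10 t12 bf a1.
have a10 : 0 <= a - 1 by rewrite subr_ge0.
have bJ := bounded_measurable_hadamard_int t10 bf a10.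
apply: (subspace_eq_continuous (f := hadamard_raw t1 1 (hadamard_int t1 (a - 1) f))).
  move=> t /[!inE] /=; rewrite in_itv/= => /andP[]; rewrite le_eqVlt => /predU1P[<-|t1t] tt2.
    (* The semigroup law is stated for [t1 < t] only; at [t1] both sides are integrals over null
       sets. *)
    have e1 : hadamard_int t1 a f t1 = 0.
      by rewrite /hadamard_int (gt_eqF (lt_le_trans ltr01 a1)) set_itv1 Rintegral_set1 mulr0.
    have e2 h : hadamard_raw t1 1 h t1 = 0.
      by rewrite /hadamard_raw set_itv_ge ?bnd_simp ?ltxx// Rintegral_set0.
    exact: (etrans (e2 _) (esym e1)).
  have ht : t1 < t <= t2 by rewrite t1t.
  have := hadamard_int_semigroup t10 bf ler01 a10 ht.
  rewrite (hadamard_int1 t10 bJ ht) (_ : 1 + (a - 1) = a); first by exact.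
  by rewrite addrC subrK.
exact: hadamard_raw1_continuous t10 t12 bJ.
Qed.

End HadamardInt.

(** * The boundary value problem *)

Section Representation.
Context {R : realType}.
Notation mu := (@lebesgue_measure R).
Implicit Types (a b c r s t u v w x y M : R) (f g : R -> R).

Lemma continuous_powR_ln t1 a t : 0 < t1 -> t1 < t ->
  {for t, continuous (fun s => ln (s / t1) `^ a)}.
Proof.
move=> t10 t1t.
have t0 : 0 < t by exact: lt_trans t1t.
apply: (@continuous_comp _ _ _ (fun s => ln (s / t1)) (@powR R ^~ a)); last first.
  by apply: continuous_powRl; rewrite ln_gt0// ltr_pdivlMr// mul1r.
apply: (@continuous_comp _ _ _ (fun s => s / t1) (@ln R)).
  by apply: continuousM; [exact: cvg_id|exact: cst_continuous].
by apply: continuous_ln; rewrite divr_gt0.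
Qed.

Lemma powR_ln_cvg0 t1 a : 0 < t1 -> 0 < a ->
  ln (t / t1) `^ a @[t --> t1^'+] --> (0 : R).
Proof.
move=> t10 a0.
have H : ln (t / t1) @[t --> t1^'+] --> (0 : R).
  rewrite -(@ln1 R) -(divff (lt0r_neq0 t10)); apply: cvg_at_right_filter.
  apply: (@continuous_comp _ _ _ (fun s => s / t1) (@ln R)).
    by apply: continuousM; [exact: cvg_id|exact: cst_continuous].
  by apply: continuous_ln; rewrite divr_gt0.
apply/cvgrPdist_lt => e e0; near=> t.
have t1t : t1 < t by near: t; exact: nbhs_right_gt.
have l0 : 0 < ln (t / t1) by rewrite ln_gt0// ltr_pdivlMr// mul1r.
rewrite sub0r normrN ger0_norm ?powR_ge0//.
have : `|0 - ln (t / t1)| < e `^ a^-1.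
  by near: t; move/cvgrPdist_lt : H; apply; exact: powR_gt0.
rewrite sub0r normrN gtr0_norm// => h.
have -> : e = (e `^ a^-1) `^ a by rewrite -powRrM mulVf ?gt_eqF// powRr1// ltW.
by rewrite gt0_ltr_powR// ?nnegrE ?powR_ge0// ltW.
Unshelve. all: by end_near. Qed.

Lemma hadamard_int_cvg0 t1 t2 a f : 0 < t1 -> t1 < t2 ->
  bounded_measurable t1 t2 f -> 0 < a ->
  hadamard_int t1 a f t @[t --> t1^'+] --> (0 : R).
Proof.
move=> t10 t12 bf a0; have [mf [M fM]] := bf.
pose K := (Gamma a)^-1 * (M * (Gamma a / Gamma (a + 1))).
have H : K * ln (t / t1) `^ a @[t --> t1^'+] --> (0 : R).
  by rewrite -(mulr0 K); apply: cvgM; [exact: cvg_cst|exact: powR_ln_cvg0].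
have HN : - (K * ln (t / t1) `^ a) @[t --> t1^'+] --> (0 : R).
  by rewrite -oppr0; exact: cvgN.
apply: (squeeze_cvgr _ HN H); near=> t.
have ht : t1 < t <= t2.
  apply/andP; split; first by near: t; exact: nbhs_right_gt.
  by near: t; apply: nbhs_right_le.
rewrite -ler_norml (hadamard_intE t10 bf a0 ht) normrM.
have G0 : 0 < (Gamma a)^-1 by rewrite invr_gt0 Gamma_gt0.
rewrite (gtr0_norm G0) /K -mulrA ler_pM2l// -mulrA.
exact: hadamard_raw_norm_le mf fM a0 ht.
Unshelve. all: by end_near. Qed.

Lemma delta_is_derive t f : 0 < t -> derivable f t 1 ->
  is_derive t (1 : R) f (delta f t / t).
Proof.
move=> t0 df; apply: DeriveDef => //.
by rewrite -derive1E /delta mulrAC divff ?mul1r// gt_eqF.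
Qed.

(** With [F = I^(2 - sigma) x] and [g = I^(1 - kappa) (q x)] the equation is
    [delta (delta F + g) = 0]. Hence [delta F = h] with [h = c - g], then [F = I^1 h], then
    [I^1 x = I^1 z] with [z = I^(sigma - 1) h], and differentiation returns [x]. *)
Lemma bvp_solution_representation t1 t2 (sigma kappa : R) (q x : R -> R) :
  0 < t1 -> t1 < t2 -> 1 < sigma <= 2 -> 0 < kappa <= sigma - 1 ->
  {within `[t1, t2], continuous q} -> bvp_solution t1 t2 sigma kappa q x ->
  exists C, forall t, t1 < t <= t2 ->
    x t = C * ln (t / t1) `^ (sigma - 1) - hadamard_int t1 (sigma - kappa) (q \* x) t.
Proof.
move=> t10 t12 /andP[s1 s2] /andP[k0 ks] cq [cx dx dqx eqx [x1 _]].
have os : hadamard_order sigma = 2%N by apply: hadamard_orderE; lra.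
have ok : hadamard_order kappa = 1%N by apply: hadamard_orderE; lra.
move: dx dqx eqx; rewrite /hadamard_derivable /hadamard_der os ok /=.
set F := hadamard_int t1 (2 - sigma) x; set g := hadamard_int t1 (1 - kappa) (q \* x).
move=> dF dg eqx.
have bx := continuous_bounded_measurable (ltW t12) cx.
have bqx := bounded_measurableM (continuous_bounded_measurable (ltW t12) cq) bx.
have bg : bounded_measurable t1 t2 g by apply: bounded_measurable_hadamard_int => //; lra.
have pos t : t1 < t < t2 -> 0 < t by move=> /andP[h _]; exact: lt_trans h.
have dFg t : t1 < t < t2 -> is_derive t (1 : R) (delta F \+ g) 0.
  move=> ht.
  have d1 := delta_is_derive (pos _ ht) (dF 1%N t isT ht).
  have d2 := delta_is_derive (pos _ ht) (dg 0%N t isT ht).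
  by apply: is_derive_eq; rewrite -mulrDl eqx// mul0r.
pose m := (t1 + t2) / 2; have hm : t1 < m < t2 by rewrite /m; lra.
have [c cE] : exists c, forall t, t1 < t < t2 -> delta F t = c - g t.
  exists (delta F m + g m) => t ht.
  have E : delta F t + g t = delta F m + g m := is_derive_0_constant dFg ht hm.
  by apply/eqP; rewrite eq_sym subr_eq eq_sym; apply/eqP.
pose h := cst c \- g.
have bh : bounded_measurable t1 t2 h.
  by apply: bounded_measurableB => //; exact: bounded_measurable_cst.
have ch t : t1 < t < t2 -> {for t, continuous h}.
  move=> ht; apply: continuousB; first exact: cst_continuous.
  by apply/differentiable_continuous/derivable1_diffP; exact: (dg 0%N).
have dFh t : t1 < t < t2 -> is_derive t (1 : R) (F \- hadamard_raw t1 1 h) 0.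
  move=> ht.
  have d1 := delta_is_derive (pos _ ht) (dF 0%N t isT ht).
  have d2 := hadamard_raw1_is_derive t10 t12 bh ht (ch _ ht).
  by apply: is_derive_eq; rewrite cE// subrr.
have Fcvg : F t @[t --> t1^'+] --> (0 : R).
  rewrite /F; have [->|sn] := eqVneq (2 - sigma) 0.
    rewrite hadamard_int0 -x1.
    by move/(continuous_within_itvP _ t12) : cx => [].
  by apply: (hadamard_int_cvg0 t10 t12 bx); rewrite lt_neqAle eq_sym sn; lra.
have hcvg : hadamard_raw t1 1 h t @[t --> t1^'+] --> (0 : R).
  have /(continuous_within_itvP _ t12) [_ H _] := hadamard_raw1_continuous t10 t12 bh.
  move: H; rewrite {2}/hadamard_raw set_itv_ge ?bnd_simp ?ltxx// Rintegral_set0; exact.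
have FE t : t1 < t < t2 -> F t = hadamard_raw t1 1 h t.
  move=> ht; apply/eqP; rewrite -subr_eq0; apply/eqP.
  have H : (F \- hadamard_raw t1 1 h) s @[s --> t1^'+] --> (0 : R).
    by rewrite -(subr0 0); exact: cvgB.
  have H2 : (F \- hadamard_raw t1 1 h) s @[s --> t1^'+] --> F t - hadamard_raw t1 1 h t.
    apply: cvg_near_cst; near=> s.
    apply: (is_derive_0_constant dFh) => //.
    apply/andP; split; first by near: s; exact: nbhs_right_gt.
    by near: s; exact: nbhs_right_lt.
  exact: (cvg_unique _ H2 H).
have s10 : 0 <= sigma - 1 by lra.
have s10' : 0 < sigma - 1 by lra.
pose z := hadamard_int t1 (sigma - 1) h.
have bz : bounded_measurable t1 t2 z by exact: bounded_measurable_hadamard_int.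
have xz t : t1 < t < t2 -> hadamard_raw t1 1 x t = hadamard_raw t1 1 z t.
  move=> /andP[t1t tt2]; have ht : t1 < t <= t2 by rewrite t1t ltW.
  have s20 : 0 <= 2 - sigma by lra.
  have bF : bounded_measurable t1 t2 F by exact: bounded_measurable_hadamard_int.
  rewrite -(hadamard_int1 t10 bx ht) -(hadamard_int1 t10 bz ht).
  have -> : 1 = (sigma - 1) + (2 - sigma) by ring.
  rewrite -(hadamard_int_semigroup t10 bx s10 s20 ht).
  have -> : sigma - 1 + (2 - sigma) = 1 by ring.
  rewrite (hadamard_int_semigroup t10 bh ler01 s10 ht).
  rewrite (addrC 1) -(hadamard_int_semigroup t10 bh s10 ler01 ht).
  apply: (eq_hadamard_int t10 bF) => // s hs; rewrite -/F FE//.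
  by rewrite (hadamard_int1 t10 bh)//; case/andP: hs => -> /ltW ->.
pose C := c / Gamma sigma.
pose w t := C * ln (t / t1) `^ (sigma - 1) - hadamard_int t1 (sigma - kappa) (q \* x) t.
have zw t : t1 < t <= t2 -> z t = w t.
  move=> ht; have k10 : 0 <= 1 - kappa by lra.
  have E1 : hadamard_int t1 (sigma - 1) g t = hadamard_int t1 (sigma - kappa) (q \* x) t.
    have <- : sigma - 1 + (1 - kappa) = sigma - kappa by ring.
    exact: hadamard_int_semigroup t10 bqx s10 k10 ht.
  have t1t : t1 < t by case/andP: ht.
  have E2 := hadamard_int_cst c t10 s10' t1t.
  have E3 := hadamard_intB t10 (bounded_measurable_cst _ _ c) bg s10' ht.
  by rewrite /z /h E3 E2 E1 subrK.
have cJ : {within `[t1, t2], continuous (hadamard_int t1 (sigma - kappa) (q \* x))}.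
  by apply: hadamard_int_continuous => //; lra.
have /(continuous_within_itvP _ t12) [cJ1 _ cJ2] := cJ.
have /(continuous_within_itvP _ t12) [cx1 _ cx2] := cx.
have cw t : t1 < t < t2 -> {for t, continuous w}.
  move=> ht; apply: continuousB; last by apply: cJ1; rewrite in_itv.
  apply: (@continuousM R R (cst C)); first exact: cst_continuous.
  by apply: continuous_powR_ln => //; case/andP: ht.
have bw : bounded_measurable t1 t2 w.
  by apply: eq_bounded_measurable bz => s /andP[h1 /ltW h2]; apply: zw; rewrite h1.
have xw t : t1 < t < t2 -> x t = w t.
  move=> ht.
  have d1 := hadamard_raw1_is_derive t10 t12 bx ht (cx1 _ ht).
  have d2 := hadamard_raw1_is_derive t10 t12 bw ht (cw _ ht).
  have near_eq : \forall s \near t, hadamard_raw t1 1 x s = hadamard_raw t1 1 w s.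
    near=> s; have hs : t1 < s < t2 by near: s; apply: near_in_itvoo; rewrite in_itv.
    rewrite xz//; apply: eq_hadamard_raw => r /andP[tr rs]; apply: zw.
    by rewrite tr/= ltW// (lt_trans rs)//; case/andP: hs.
  have E := near_eq_derive (1 : R) near_eq.
  have [_ e1] := d1; have [_ e2] := d2; rewrite e1 e2 in E.
  have tn0 : t != 0 by rewrite gt_eqF// pos.
  by rewrite -(divfK tn0 (x t)) E divfK.
exists C => t /andP[t1t]; rewrite le_eqVlt => /predU1P[->|tt2]; last by apply: xw; rewrite t1t.
(* Differentiation gives [x = w] inside the interval only; the endpoint [t2] follows by taking left
   limits of both. *)
have w2 : w s @[s --> t2^'-] --> w t2.
  apply: cvgB => //; apply: cvgM; first exact: cvg_cst.
  by apply: cvg_at_left_filter; exact: continuous_powR_ln.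
have x2 : w s @[s --> t2^'-] --> x t2.
  apply: cvg_trans cx2; apply: near_eq_cvg; near=> s; apply/xw.
  apply/andP; split; last by near: s; exact: nbhs_left_lt.
  by near: s; exact: nbhs_left_gt.
exact: (cvg_unique _ x2 w2).
Unshelve. all: by end_near. Qed.

End Representation.

(** * The maximum-point argument *)

Lemma green_kernel_bound (R : realType) (t1 t2 sigma kappa t s : R) :
  0 < t1 -> t1 < t2 -> 1 < sigma <= 2 -> 0 < kappa <= sigma - 1 ->
  t1 < t <= t2 -> t1 < s < t2 ->
  `|(ln (t / t1) / ln (t2 / t1)) `^ (sigma - 1) * ln (t2 / s) `^ (sigma - kappa - 1)
    - (if s < t then ln (t / s) `^ (sigma - kappa - 1) else 0)| / s
  <= Num.max (Omega t1 t2 sigma kappa) (Mho t1 t2 sigma kappa).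
Proof.
move=> t10 t12 hs hk /andP[t1t tt2] /andP[t1s st2].
have s0 : 0 < s by exact: lt_trans t1s.
have t0 : 0 < t by exact: lt_trans t1t.
have t20 : 0 < t2 by exact: lt_trans t12.
have u0 : 0 < ln (t / t1) <= ln (t2 / t1).
  rewrite ln_gt0 ?ltr_pdivlMr ?mul1r//=.
  by rewrite ler_ln ?posrE ?divr_gt0// ler_wpM2r// invr_ge0 ltW.
have v0 : 0 < ln (s / t1) < ln (t2 / t1).
  rewrite ln_gt0 ?ltr_pdivlMr ?mul1r//=.
  by rewrite ltr_ln ?posrE ?divr_gt0// ltr_pM2r ?invr_gt0.
have := green_bound t10 t12 hs hk u0 v0.
have -> : t1 * expR (ln (s / t1)) = s.
  by rewrite lnK ?posrE ?divr_gt0// mulrC divfK ?gt_eqF.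
have E r : 0 < r -> ln (r / t1) - ln (s / t1) = ln (r / s).
  by move=> r0; rewrite !ln_div ?posrE//; ring.
rewrite !E// ltr_ln ?posrE ?divr_gt0// ltr_pM2r ?invr_gt0//.
Qed.

Theorem corollary10 (R : realType) (t1 t2 sigma kappa : R) (q : R -> R)
  (t1_gt0 : 0 < t1) (t1_lt_t2 : t1 < t2)
  (sigma_bnd : 1 < sigma <= 2) (kappa_bnd : 0 < kappa <= sigma - 1)
  (q_cont : {within `[t1, t2], continuous q})
  (q_small : \int[@lebesgue_measure R]_(s in `[t1, t2]) `|q s| <
     Gamma (sigma - kappa)
     / Num.max (Omega t1 t2 sigma kappa) (Mho t1 t2 sigma kappa)) :
  ~ exists x : R -> R,
      bvp_solution t1 t2 sigma kappa q x /\
      exists2 t, t1 <= t <= t2 & x t <> 0.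
Proof.
move=> [x [sol [t' ht' xt'0]]].
have [cx _ _ _ [x1 x2]] := sol.
have [C xE] := bvp_solution_representation t1_gt0 t1_lt_t2 sigma_bnd kappa_bnd q_cont sol.
move: (sigma_bnd) (kappa_bnd) => /andP[s1 s2] /andP[k0 ks].
have t12 := ltW t1_lt_t2.
have [t0 /[!in_itv]/= /andP[t1t0 t0t2] xmax] := EVT_max t12 (within_continuous_norm cx).
have N0 : 0 < `|x t0|.
  apply: lt_le_trans (xmax t' _); last by rewrite in_itv.
  by rewrite normr_gt0; exact/eqP.
(* The representation fails to cover [t1], but the maximum is positive and [x t1 = 0]. *)
have ht0 : t1 < t0 <= t2.
  rewrite t0t2 andbT lt_neqAle t1t0 andbT; apply/eqP => E.
  by move: N0; rewrite -E x1 normr0 ltxx.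
have ht2 : t1 < t2 <= t2 by rewrite t1_lt_t2 lexx.
have b0 : 0 < sigma - kappa by lra.
have bq := continuous_bounded_measurable t12 q_cont.
have bf := bounded_measurableM bq (continuous_bounded_measurable t12 cx).
set M := Num.max _ _ in q_small.
have M0 : 0 < M by rewrite lt_max Mho_gt0 ?orbT.
set L := ln (t2 / t1); set u := ln (t0 / t1).
have L0 : 0 < L by rewrite ln_gt0// ltr_pdivlMr// mul1r.
have u0 : 0 < u by rewrite ln_gt0// ltr_pdivlMr// mul1r; case/andP: ht0.
pose k := (u / L) `^ (sigma - 1).
pose A s := ln (t2 / s) `^ (sigma - kappa - 1) * ((q \* x) s / s).
pose B s := ln (t0 / s) `^ (sigma - kappa - 1) * ((q \* x) s / s).
(* Extending the second term by 0 past [t0] puts both terms of the Green function under one integral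
   over []t1, t2[]. *)
pose BT := B \_ [set s | s < t0].
have iA : (@lebesgue_measure R).-integrable `]t1, t2[ (EFin \o A).
  exact: hadamard_raw_integrable t1_gt0 bf b0 ht2.
have setI_t0 : `]t1, t2[ `&` [set s | s < t0] = `]t1, t0[%classic.
  apply/seteqP; split=> s /=; rewrite !in_itv/=; first by move=> [/andP[-> _] ->].
  by move=> /andP[-> h]; rewrite (lt_le_trans h t0t2).
have iBT : (@lebesgue_measure R).-integrable `]t1, t2[ (EFin \o BT).
  have mS : measurable [set s | s < t0].
    have -> : [set s | s < t0] = `]-oo, t0[%classic.
      by apply/seteqP; split=> s /=; rewrite in_itv.
    exact: measurable_itv.
  rewrite /BT -restrict_EFin; apply/integrable_restrict => //.
  by rewrite setI_t0; exact: hadamard_raw_integrable t1_gt0 bf b0 ht0.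
have xt0 : x t0 = (Gamma (sigma - kappa))^-1 *
    \int[@lebesgue_measure R]_(s in `]t1, t2[) (k * A s - BT s).
  (* This is the representation at [t2] with [x t2 = 0]. *)
  have CE : C = hadamard_int t1 (sigma - kappa) (q \* x) t2 / L `^ (sigma - 1).
    have := xE _ ht2; rewrite x2 => /esym/eqP; rewrite subr_eq0 => /eqP <-.
    by rewrite mulfK// gt_eqF// powR_gt0.
  rewrite xE// CE !(hadamard_intE t1_gt0 bf b0)// RintegralB//; last first.
    exact: (integrableZl _ k iA).
  rewrite RintegralZl// mulrBr; congr (_ - _); last first.
    by rewrite /BT -Rintegral_mkcondr setI_t0.
  have -> : k = u `^ (sigma - 1) / L `^ (sigma - 1).
    have Li : L^-1 = L `^ (-1) by rewrite powR_inv1 ?ltW.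
    by rewrite /k powRM ?invr_ge0 ?(ltW u0) ?(ltW L0)// Li -powRrM mulN1r powRN.
  rewrite -/u -/(hadamard_raw t1 (sigma - kappa) (q \* x) t2); ring.
have bound s : `]t1, t2[%classic s -> `|k * A s - BT s| <= M * `|x t0| * `|q s|.
  rewrite /= in_itv/= => /[dup] hs /andP[t1s st2].
  have s0 : 0 < s by exact: lt_trans t1s.
  have -> : k * A s - BT s = (k * ln (t2 / s) `^ (sigma - kappa - 1) -
      (if s < t0 then ln (t0 / s) `^ (sigma - kappa - 1) else 0)) / s * (q s * x s).
    have [st|ts] := ltP s t0.
      by rewrite /BT patchE mem_set// /A /B /=; ring.
    have -> : BT s = 0 by rewrite /BT patchE memNset//= ltNge ts.
    by rewrite /A /=; ring.
  rewrite normrM normrM normfV (gtr0_norm s0) normrM.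
  rewrite -[leRHS]mulrA [`|x t0| * _]mulrC; apply: ler_pM => //.
  - by rewrite mulr_ge0// invr_ge0 ltW.
  - exact: green_kernel_bound.
  - by rewrite ler_wpM2l// xmax// in_itv/= !ltW.
have iq : (@lebesgue_measure R).-integrable `[t1, t2] (EFin \o (fun s => `|q s|)).
  apply: continuous_compact_integrable; first exact: segment_compact.
  exact: within_continuous_norm.
have iq' : (@lebesgue_measure R).-integrable `]t1, t2[ (EFin \o (fun s => `|q s|)).
  by apply: integrableS iq => //; exact: subset_itv_oo_cc.
have G0 : 0 < Gamma (sigma - kappa) by exact: Gamma_gt0.
have ikAB : (@lebesgue_measure R).-integrable `]t1, t2[ (EFin \o (fun s => k * A s - BT s)).
  exact: (integrableB _ (integrableZl _ k iA) iBT).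
have : `|x t0| <= (Gamma (sigma - kappa))^-1 *
    (M * `|x t0| * \int[@lebesgue_measure R]_(s in `[t1, t2]) `|q s|).
  rewrite {1}xt0 normrM gtr0_norm ?invr_gt0// ler_pM2l ?invr_gt0//.
  apply: le_trans (le_normr_Rintegral _ _) _ => //.
  have -> : \int[@lebesgue_measure R]_(s in `[t1, t2]) `|q s| =
            \int[@lebesgue_measure R]_(s in `]t1, t2[) `|q s|.
    rewrite /Rintegral integral_itv_bndoo//.
    exact: measurable_int iq'.
  rewrite -RintegralZl//; apply: le_Rintegral => //.
  - exact: integrable_norm ikAB.
  - exact: (integrableZl _ (M * `|x t0|) iq').
(* Cancelling the positive factor at the maximum leaves the reverse of the strict smallness
   assumption. *)
apply/negP; rewrite -ltNge ltr_pdivrMl// mulrAC ltr_pM2r//.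
by rewrite mulrC -ltr_pdivlMr.
Qed.
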